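(* Let $A$ be an artin algebra with simple right modules indexed (up to isomorphism) by $I$, let $\leq$ be a total order on $I$, say $i_1<i_2<\cdots<i_n$, and let $$A=H_0 > H_1 > \cdots > H_{n}=0 \qquad ( * )$$ be the maximal chain of idempotent ideals corresponding to $\leq$, that is, $H_j=A(e_{i_{j+1}}+\cdots+e_{i_n})A$ for $0\le j\le n$, where $e_i$ is a primitive idempotent of $A$ corresponding to the simple module $S(i)$. Then $(A, \leq)$ is a right-strongly (resp. left-strongly) quasi-hereditary algebra if and only if $( * )$ is a right-strongly (resp. left-strongly) heredity chain.
   Context: All modules are finitely generated; $J(A)$ is the Jacobson radical of $A$. $\{S(i)\mid i\in I\}$ is a complete set of representatives of isomorphism classes of simple right $A$-modules, and $P(i)$ is the projective cover of $S(i)$ (so $P(i)\cong e_iA$). Simple left modules (simple right $A^{\mathrm{op}}$-modules) are indexed by the same set $I$ via the primitive idempotents $e_i$. A chain of idempotent ideals is maximal if its length $n$ equals the number $|I|$ of simple modules. A chain of idempotent ideals $A=H_0>H_1>\cdots>H_n=0$ is a right-strongly (resp. left-strongly) heredity chain if for every $0\le i\le n-1$: (a) $H_i$ is projective as a right (resp. left) $A$-module; (b) $(H_i/H_{i+1})\,J(A/H_{i+1})\,(H_i/H_{i+1})=0$. Given a partial order $\le$ on $I$, the standard module $\Delta(i)$ is the maximal factor module of $P(i)$ all of whose composition factors have the form $S(j)$ with $j\le i$. $\mathcal F(\Delta)$ is the full subcategory of modules $M$ having a chain of submodules $M=M_0\supseteq M_1\supseteq\cdots\supseteq M_l=0$ whose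 successive quotients are each isomorphic to some standard module; $(M:\Delta(j))$ denotes the number of quotients isomorphic to $\Delta(j)$ (filtration multiplicity). The pair $(A,\le)$ is right-strongly quasi-hereditary if for every $i\in I$ we have $[\Delta(i):S(i)]=1$ (composition multiplicity), and the kernel $K(i)$ in $0\to K(i)\to P(i)\to\Delta(i)\to0$ satisfies: (a) $K(i)\in\mathcal F(\Delta)$; (b) if $(K(i):\Delta(j))\ne0$ then $i<j$; (c) $K(i)$ is a projective right $A$-module (equivalently, $\Delta(i)$ has projective dimension at most one). The pair $(A,\le)$ is left-strongly quasi-hereditary if $(A^{\mathrm{op}},\le)$ is right-strongly quasi-hereditary. *)

(* Defs.v *)
From HB Require Import structures.
From mathcomp Require Import all_boot all_order all_algebra.
From mathcomp Require Import generic_quotient.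
From mathcomp Require Import boolp classical_sets.

Set Implicit Arguments.
Unset Strict Implicit.
Unset Printing Implicit Defensive.

Import Order.TTheory GRing.Theory.
Local Open Scope ring_scope.
Local Open Scope quotient_scope.
Local Open Scope classical_set_scope.

(* Modules are [lmodType]s.  A right module over [A] is a left module over the
   converse ring [A^c], in which [x * y] is the product [y * x] of [A]. *)
Notation rmodType A := (lmodType (GRing.converse A)).

(* [A] as a right module over itself: [a *: x] is the product [x * a] of [A]. *)
Notation rreg A := (GRing.regular (GRing.converse A)).

Section Submodules.
Variables (R : pzRingType) (M : lmodType R).

Record submod := Submod {
  submod_pred :> {pred M};
  submodP : submod_closed submod_pred }.

Lemma submod_subsemimod (N : submod) : subsemimod_closed N.
Proof. exact: (GRing.submod_closed_semi (submodP N)). Qed.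

HB.instance Definition _ (N : submod) :=
  GRing.isSubmodClosed.Build R M (submod_pred N) (submod_subsemimod N).

Record submodule (N : submod) := SubmoduleElt {
  submodule_val : M;
  _ : submodule_val \in (N : {pred M}) }.

HB.instance Definition _ (N : submod) := [isSub for @submodule_val N].
HB.instance Definition _ (N : submod) := [Choice of submodule N by <:].
HB.instance Definition _ (N : submod) :=
  [SubChoice_isSubLmodule of submodule N by <:].

End Submodules.

Section QuotientModule.
Variables (R : pzRingType) (M : lmodType R) (N : submod M).

Definition quomodule : Type := Quotient.quot (N : zmodClosed M).
HB.instance Definition _ := GRing.Zmodule.on quomodule.

Definition quomodule_pi (x : M) : quomodule := \pi_(Quotient.quot N) x.
Definition quomodule_scale (a : R) (x : quomodule) : quomodule :=
  quomodule_pi (a *: repr (x : Quotient.quot N)).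

Lemma quomodule_repr (x : quomodule) :
  quomodule_pi (repr (x : Quotient.quot N)) = x.
Proof. exact: reprK. Qed.

Lemma quomodule_eq (x y : M) :
  (quomodule_pi x == quomodule_pi y) = (x - y \in (N : {pred M})).
Proof. exact: (esym (Quotient.idealrBE _ _ _)). Qed.

Lemma quomodule_piB (x y : M) :
  quomodule_pi (x - y) = quomodule_pi x - quomodule_pi y.
Proof. exact: (raddfB (\pi_(Quotient.quot N))). Qed.

Lemma quomodule_piD (x y : M) :
  quomodule_pi (x + y) = quomodule_pi x + quomodule_pi y.
Proof. exact: (raddfD (\pi_(Quotient.quot N))). Qed.

Lemma quomodule_scaleE a (x : M) :
  quomodule_scale a (quomodule_pi x) = quomodule_pi (a *: x).
Proof.
apply/eqP; rewrite quomodule_eq -scalerBr; apply: rpredZ.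
by rewrite -quomodule_eq quomodule_repr.
Qed.

Lemma quomodule_scaleA a b x :
  quomodule_scale a (quomodule_scale b x) = quomodule_scale (a * b) x.
Proof. by rewrite -[x]quomodule_repr !quomodule_scaleE scalerA. Qed.

Lemma quomodule_scale1 : left_id 1 quomodule_scale.
Proof. by move=> x; rewrite -[x]quomodule_repr quomodule_scaleE scale1r. Qed.

Lemma quomodule_scaleDr : right_distributive quomodule_scale +%R.
Proof.
move=> a x y; rewrite -[x]quomodule_repr -[y]quomodule_repr.
by rewrite -quomodule_piD !quomodule_scaleE -quomodule_piD scalerDr.
Qed.

Lemma quomodule_scaleDl x :
  {morph quomodule_scale^~ x : a b / a + b}.
Proof.
move=> a b; rewrite -[x]quomodule_repr !quomodule_scaleE.
by rewrite -quomodule_piD scalerDl.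
Qed.

HB.instance Definition _ := GRing.Zmodule_isLmodule.Build R quomodule
  quomodule_scaleA quomodule_scale1 quomodule_scaleDr quomodule_scaleDl.

End QuotientModule.

Section Subquotient.
Variables (R : pzRingType) (M : lmodType R) (N N' : submod M).

Definition trace_pred : {pred submodule N} := [pred x | val x \in N'].

Lemma trace_closed : submod_closed trace_pred.
Proof.
split=> [|a x y]; rewrite !inE ?raddf0 ?rpred0 // => xN yN.
have -> : val (a *: x + y) = a *: val x + val y by [].
by rewrite rpredD ?rpredZ.
Qed.

(* [N / N'] for [N' <= N]; in general [N / (N :&: N')]. *)
Definition subquo : lmodType R := quomodule (Submod trace_closed).

End Subquotient.

Definition isomorphic (R : pzRingType) (M N : lmodType R) : Prop :=
  exists f : {linear M -> N}, bijective f.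

Definition surjective (S T : Type) (f : S -> T) : Prop :=
  forall y, exists x, f x = y.

Definition simple_module (R : pzRingType) (M : lmodType R) : Prop :=
  (exists x : M, x != 0) /\
  forall N : submod M, (forall x, x \in N -> x = 0) \/ (forall x, x \in N).

Definition projective (R : pzRingType) (P : lmodType R) : Prop :=
  forall (M N : lmodType R) (g : {linear M -> N}) (f : {linear P -> N}),
    surjective g -> exists h : {linear P -> M}, forall x, g (h x) = f x.

(* The last clause says that the kernel of [p] is superfluous. *)
Definition projective_cover (R : pzRingType) (P S : lmodType R) : Prop :=
  projective P /\
  exists p : {linear P -> S}, surjective p /\
    forall N : submod P,
      (forall x, exists y z, [/\ y \in N, p z = 0 & x = y + z]) ->
      forall x, x \in N.

Definition artinian (R : pzRingType) (M : lmodType R) : Prop :=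
  forall N : nat -> submod M,
    (forall k, {subset N k.+1 <= N k}) ->
    exists m, forall k, (m <= k)%N -> N k =i N m.

Definition fg_module (R : pzRingType) (M : lmodType R) : Prop :=
  exists (m : nat) (g : 'I_m -> M),
    forall x, exists c : 'I_m -> R, x = \sum_i c i *: g i.

Definition artin_algebra (k : comNzRingType) (A : algType k) : Prop :=
  artinian k^o /\ fg_module A.

(* [N 0 >= N 1 >= ... >= N l], with [N 0] everything and [N l] zero; the values
   of [N] beyond [l] are irrelevant. *)
Definition filtration (R : pzRingType) (M : lmodType R)
    (l : nat) (N : nat -> submod M) : Prop :=
  [/\ forall x, x \in N 0%N,
      forall x, x \in N l -> x = 0 &
      forall k, (k < l)%N -> {subset N k.+1 <= N k}].

Definition layer (R : pzRingType) (M : lmodType R) (N : nat -> submod M)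
  (k : nat) : lmodType R := subquo (N k) (N k.+1).

Definition count_layers (R : pzRingType) (M : lmodType R) (l : nat)
    (N : nat -> submod M) (T : lmodType R) : nat :=
  #|[pred k : 'I_l | `[< isomorphic (layer N k) T >]]|.

Definition composition_series (R : pzRingType) (M : lmodType R)
    (l : nat) (N : nat -> submod M) : Prop :=
  filtration l N /\ forall k, (k < l)%N -> simple_module (layer N k).

(* [M : T] = m, for T simple; a relation, single-valued by Jordan-Hoelder. *)
Definition composition_multiplicity (R : pzRingType) (M T : lmodType R)
    (m : nat) : Prop :=
  exists l N, @composition_series R M l N /\ count_layers l N T = m.

Definition delta_filtration (R : pzRingType) (I : Type) (Delta : I -> lmodType R)
    (M : lmodType R) (l : nat) (N : nat -> submod M) : Prop :=
  filtration l N /\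
  forall k, (k < l)%N -> exists i, isomorphic (layer N k) (Delta i).

Definition delta_filtered (R : pzRingType) (I : Type)
    (Delta : I -> lmodType R) (M : lmodType R) : Prop :=
  exists l N, @delta_filtration R I Delta M l N.

(* (M : Delta(j)) = m, as a relation *)
Definition delta_multiplicity (R : pzRingType) (I : Type)
    (Delta : I -> lmodType R) (M : lmodType R) (j : I) (m : nat) : Prop :=
  exists l N, @delta_filtration R I Delta M l N /\
    count_layers l N (Delta j) = m.

Section QuasiHereditary.
Context {R : pzRingType} {d : Order.disp_t} {I : finPOrderType d}.
Variables (S P : I -> lmodType R).

Definition factors_le (i : I) (M : lmodType R) : Prop :=
  forall l N, @composition_series R M l N ->
    forall k, (k < l)%N ->
      exists2 j : I, (j <= i)%O & isomorphic (layer N k) (S j).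

(* The standard module Delta(i) is [P i / K]: its being the maximal factor module
   means that [K] is the least submodule of [P i] with the property. *)
Definition standard_kernel (i : I) (K : submod (P i)) : Prop :=
  factors_le i (quomodule K) /\
  forall K' : submod (P i), factors_le i (quomodule K') -> {subset K <= K'}.

Definition strongly_quasi_hereditary : Prop :=
  exists K : forall i, submod (P i),
    let Delta i : lmodType R := quomodule (K i) in
    (forall i, standard_kernel (K i)) /\
    forall i,
      [/\ composition_multiplicity (Delta i) (S i) 1,
          delta_filtered Delta (submodule (K i)),
          forall j m, delta_multiplicity Delta (submodule (K i)) j m ->
            m <> 0%N -> (i < j)%O
        & projective (submodule (K i))].

End QuasiHereditary.

Definition primitive_idempotent (A : pzRingType) (e : A) : Prop :=
  [/\ e * e = e, e != 0 &
      forall f g : A, f * f = f -> g * g = g -> f * g = 0 -> g * f = 0 ->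
        e = f + g -> f = 0 \/ g = 0].

Section PrincipalRightIdeal.
Variables (A : pzRingType) (e : A).

Definition pright_pred : {pred rreg A} :=
  [pred x | `[< exists a : A, (e * a : A) = x >]].

Lemma pright_closed : submod_closed pright_pred.
Proof.
split=> [|a x y]; rewrite !inE; first by exists 0; rewrite mulr0.
move=> [b <-] [c <-]; exists (b * a + c).
by rewrite mulrDr mulrA.
Qed.

(* the right module e A *)
Definition pright : rmodType A := submodule (Submod pright_closed).

End PrincipalRightIdeal.

Record ideal (A : pzRingType) := Ideal {
  ideal_pred :> {pred A};
  ideal_zmod_closed : zmod_closed ideal_pred;
  ideal_mull : forall a x : A, x \in ideal_pred -> a * x \in ideal_pred;
  ideal_mulr : forall a x : A, x \in ideal_pred -> x * a \in ideal_pred }.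

HB.instance Definition _ (A : pzRingType) (H : ideal A) :=
  GRing.isZmodClosed.Build A (ideal_pred H) (ideal_zmod_closed H).

Section IdealModules.
Variables (A : pzRingType) (H : ideal A).

Lemma ideal_right_closed : submod_closed (H : {pred rreg A}).
Proof.
split=> [|a x y xH yH]; first exact: (rpred0 H).
have : ((x : A) * (a : A) + y : A) \in H by apply: rpredD => //; exact: ideal_mulr.
by [].
Qed.

Lemma ideal_left_closed : submod_closed (H : {pred A^o}).
Proof.
split=> [|a x y xH yH]; first exact: (rpred0 H).
have : ((a : A) * (x : A) + y : A) \in H by apply: rpredD => //; exact: ideal_mull.
by [].
Qed.

Definition ideal_rmodule : rmodType A := submodule (Submod ideal_right_closed).
Definition ideal_lmodule : lmodType A := submodule (Submod ideal_left_closed).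

End IdealModules.

Section QuotientRing.
Variables (A : pzRingType) (H : ideal A).

Definition quoring : Type := Quotient.quot (H : zmodClosed A).
HB.instance Definition _ := GRing.Zmodule.on quoring.

Definition quoring_pi (x : A) : quoring := \pi_(Quotient.quot H) x.
Definition quoring_mul (x y : quoring) : quoring :=
  quoring_pi (repr (x : Quotient.quot H) * repr (y : Quotient.quot H)).

Lemma quoring_repr (x : quoring) :
  quoring_pi (repr (x : Quotient.quot H)) = x.
Proof. exact: reprK. Qed.

Lemma quoring_eq (x y : A) :
  (quoring_pi x == quoring_pi y) = (x - y \in (H : {pred A})).
Proof. exact: (esym (Quotient.idealrBE _ _ _)). Qed.

Lemma quoring_piD (x y : A) : quoring_pi (x + y) = quoring_pi x + quoring_pi y.
Proof. exact: (raddfD (\pi_(Quotient.quot H))). Qed.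

Lemma quoring_mulE (x y : A) :
  quoring_mul (quoring_pi x) (quoring_pi y) = quoring_pi (x * y).
Proof.
rewrite /quoring_mul; set x' := repr _; set y' := repr _.
have xx' : x' - x \in H by rewrite -quoring_eq quoring_repr.
have yy' : y' - y \in H by rewrite -quoring_eq quoring_repr.
apply/eqP; rewrite quoring_eq.
have -> : x' * y' - x * y = (x' - x) * y' + x * (y' - y).
  by rewrite mulrBl mulrBr addrA subrK.
by apply: rpredD; [exact: ideal_mulr | exact: ideal_mull].
Qed.

Lemma quoring_mulA : associative quoring_mul.
Proof.
move=> x y z; rewrite -[x]quoring_repr -[y]quoring_repr -[z]quoring_repr.
by rewrite !quoring_mulE mulrA.
Qed.

Lemma quoring_mul1r : left_id (quoring_pi 1) quoring_mul.
Proof. by move=> x; rewrite -[x]quoring_repr quoring_mulE mul1r. Qed.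

Lemma quoring_mulr1 : right_id (quoring_pi 1) quoring_mul.
Proof. by move=> x; rewrite -[x]quoring_repr quoring_mulE mulr1. Qed.

Lemma quoring_mulDl : left_distributive quoring_mul +%R.
Proof.
move=> x y z; rewrite -[x]quoring_repr -[y]quoring_repr -[z]quoring_repr.
by rewrite -quoring_piD !quoring_mulE -quoring_piD mulrDl.
Qed.

Lemma quoring_mulDr : right_distributive quoring_mul +%R.
Proof.
move=> x y z; rewrite -[x]quoring_repr -[y]quoring_repr -[z]quoring_repr.
by rewrite -quoring_piD !quoring_mulE -quoring_piD mulrDr.
Qed.

HB.instance Definition _ := GRing.Zmodule_isPzRing.Build quoring
  quoring_mulA quoring_mul1r quoring_mulr1 quoring_mulDl quoring_mulDr.

End QuotientRing.

(* The additive subgroup generated by the products [x * y], x in X, y in Y. *)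
Definition prodset (A : pzRingType) (X Y : set A) : set A :=
  [set z | exists2 s : seq (A * A),
     (forall p, p \in s -> X p.1 /\ Y p.2) & z = \sum_(p <- s) p.1 * p.2].

Lemma prodset0 (A : pzRingType) (X Y : set A) : prodset X Y 0.
Proof. by exists [::]; rewrite ?big_nil. Qed.

Lemma prodsetD (A : pzRingType) (X Y : set A) (x y : A) :
  prodset X Y x -> prodset X Y y -> prodset X Y (x + y).
Proof.
move=> [s sXY ->] [t tXY ->]; exists (s ++ t); last by rewrite big_cat.
by move=> p; rewrite mem_cat => /orP[/sXY|/tXY].
Qed.

Lemma prodset_mull (A : pzRingType) (X Y : set A) (a x : A) :
  (forall y, X y -> X (a * y)) -> prodset X Y x -> prodset X Y (a * x).
Proof.
move=> aX [s sXY ->]; exists [seq (a * p.1, p.2) | p <- s].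
  by move=> _ /mapP[p /sXY[Xp Yp] ->]; split=> //; exact: aX.
by rewrite big_map mulr_sumr; apply: eq_bigr => p _; rewrite mulrA.
Qed.

Lemma prodset_mulr (A : pzRingType) (X Y : set A) (a x : A) :
  (forall y, Y y -> Y (y * a)) -> prodset X Y x -> prodset X Y (x * a).
Proof.
move=> Ya [s sXY ->]; exists [seq (p.1, p.2 * a) | p <- s].
  by move=> _ /mapP[p /sXY[Xp Yp] ->]; split=> //; exact: Ya.
by rewrite big_map mulr_suml; apply: eq_bigr => p _; rewrite mulrA.
Qed.

Section GeneratedIdeal.
Variables (A : pzRingType) (u : A).

Definition gen_pred : {pred A} :=
  [pred x | `[< prodset (prodset setT [set u]) setT x >]].

Lemma gen_mull (a x : A) : x \in gen_pred -> a * x \in gen_pred.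
Proof.
rewrite !inE => xu.
by apply: prodset_mull xu => y; exact: prodset_mull.
Qed.

Lemma gen_mulr (a x : A) : x \in gen_pred -> x * a \in gen_pred.
Proof.
by rewrite !inE => xu; exact: prodset_mulr xu.
Qed.

Lemma gen_zmod_closed : zmod_closed gen_pred.
Proof.
split=> [|x y xu yu]; first by rewrite inE; exact: prodset0.
have := gen_mull (-1) yu; move: xu; rewrite !inE mulN1r.
by move=> xu' yu'; exact: prodsetD.
Qed.

(* the two-sided ideal A u A *)
Definition gen_ideal : ideal A := Ideal gen_zmod_closed gen_mull gen_mulr.

End GeneratedIdeal.

Definition jacobson (A : pzRingType) : set A :=
  [set x | forall N : submod (rreg A),
     (exists y, y \notin N) ->
     (forall N' : submod (rreg A), {subset N <= N'} ->
        (forall y, y \in N') \/ {subset N' <= N}) ->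
     x \in N].
Arguments jacobson : clear implicits.

(* A = H 0 > H 1 > ... > H n = 0; the values of [H] beyond [n] are irrelevant. *)
Definition idempotent_ideal_chain (A : pzRingType) (n : nat)
    (H : nat -> ideal A) : Prop :=
  [/\ forall x, x \in H 0%N,
      forall x, x \in H n -> x = 0,
      forall i, (i < n)%N ->
        {subset H i.+1 <= H i} /\ exists2 x, x \in H i & x \notin H i.+1 &
      forall i, (i <= n)%N ->
        prodset [set` H i] [set` H i] = [set` H i]].

(* (H / H') J(A / H') (H / H') = 0 *)
Definition radical_condition (A : pzRingType) (H H' : ideal A) : Prop :=
  let HH' : set (quoring H') := quoring_pi H' @` [set` H] in
  prodset (prodset HH' (jacobson (quoring H'))) HH' = [set 0].

Definition right_strongly_heredity_chain (A : pzRingType) (n : nat)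
    (H : nat -> ideal A) : Prop :=
  idempotent_ideal_chain n H /\
  forall i, (i < n)%N ->
    projective (ideal_rmodule (H i)) /\ radical_condition (H i) (H i.+1).

Definition left_strongly_heredity_chain (A : pzRingType) (n : nat)
    (H : nat -> ideal A) : Prop :=
  idempotent_ideal_chain n H /\
  forall i, (i < n)%N ->
    projective (ideal_lmodule (H i)) /\ radical_condition (H i) (H i.+1).

(* [Order.enum_val] lists [I] increasingly from index 0, so that the sum runs
   over i_(j+1) < ... < i_n in the numbering i_1 < ... < i_n of [I]. *)
Definition order_chain (A : pzRingType) (d : Order.disp_t) (I : finOrderType d)
    (e : I -> A) (j : nat) : ideal A :=
  gen_ideal (\sum_(k < #|I| | (j <= k)%N) e (Order.enum_val k)).

Definition simple_representatives (R : pzRingType) (I : Type)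
    (S : I -> lmodType R) : Prop :=
  [/\ forall i, simple_module (S i),
      forall i j, isomorphic (S i) (S j) -> i = j &
      forall M : lmodType R, simple_module M -> exists i, isomorphic M (S i)].

Definition right_strongly_quasi_hereditary (A : pzRingType) (d : Order.disp_t)
    (I : finPOrderType d) (e : I -> A) (S : I -> rmodType A) : Prop :=
  strongly_quasi_hereditary S (fun i => pright (e i)).

Definition left_strongly_quasi_hereditary (A : pzRingType) (d : Order.disp_t)
    (I : finPOrderType d) (e : I -> A) (S : I -> rmodType A^c) : Prop :=
  @right_strongly_quasi_hereditary A^c d I e S.

(* Main.v *)
Require Import Defs.
From HB Require Import structures.
From mathcomp Require Import all_boot all_order all_algebra.
From mathcomp Require Import generic_quotient boolp classical_sets.

(* Write H_m for the m-th ideal of the chain.  The standard module Delta(i) is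
   e_i A / e_i H', where H' is the ideal generated by the e_j with j > i, and
   K(i) = e_i H'.

   Two conditions on both sides of the equivalence agree for local reasons:
   [Delta(i) : S(i)] = 1 and the radical condition each say that e_i is not in
   H' while every non-invertible element of e_i A e_i is.  It remains to compare
   the projectivity of the K(i), together with their filtrations by standard
   modules, with that of the H_m.

   If all K(i) are projective, then so is e_i H_m for every m: it is e_i A when
   e_i is in H_m, and otherwise it is K(i) H_m, where K(i) is a direct summand of
   a finite sum of modules e_l A with l > i, so that a descending induction on i
   applies.  As A is a direct summand of a finite sum of the e_l A, every H_m is
   then projective.

   Conversely e_i H_m is a direct summand of H_m.  When it is projective, the
   layer e_i H_m / e_i H_(m+1) is a direct sum of copies of one standard module,
   so K(i) is filtered by the Delta(j) with j > i.  No other Delta(j) occurs in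
   any standard filtration of K(i), because K(i) = K(i) H'.

   The conditions used on the idempotents e_i are left-right symmetric, and the
   left statement is the right one for the opposite algebra. *)

Set Implicit Arguments.
Unset Strict Implicit.
Unset Printing Implicit Defensive.

Import Order.TTheory GRing.Theory.
Local Open Scope ring_scope.

(** * Chain conditions on submodules *)

(** The [e i] are not given as orthogonal or with sum 1, and [H_m] is generated by the sum of some
    [e j], which does not visibly contain each of them. The record [local_idempotents] collects what
    stands in for orthogonality: every corner [e i A e i] is local, for [i <> j] no unit of
    [e i A e i] factors through [e j], and the [e i] together generate [A] as an ideal. On the left
    only simple modules with their covers are given, so the record is derived from the right modules
    and then transported to [A^c]. Projectivity is handled by dual bases, that is, finite families
    of elements and functionals. The same one-sided ideal occurs under several module types (inside
    [A], inside [e i A], over the converse ring), and a dual basis depends only on its elements.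
    Finite families require [A] to be noetherian on both sides, while an artin algebra only comes
    with an artinian base ring [k]; hence the theorem that commutative artinian rings are
    noetherian. *)

Section Submod.
Variables (R : pzRingType) (M : lmodType R).
Implicit Types X Y : submod M.

Lemma submod_ext X Y : X =i Y -> X = Y.
Proof.
case: X Y => [p hp] [q hq] pq.
have E : p = q by apply: funext => x; exact: pq.
by case: q / E hq {pq} => hq; congr Submod; exact: Prop_irrelevance.
Qed.

Section Of.
Variable P : M -> Prop.
Hypotheses (P0 : P 0) (PD : forall a x y, P x -> P y -> P (a *: x + y)).

Lemma submod_of_closed : submod_closed [pred x : M | `[< P x >]].
Proof.
by split=> [|a x y]; rewrite !inE //; exact: PD.
Qed.

Definition submod_of : submod M := Submod submod_of_closed.

Lemma submod_ofE x : (x \in submod_of) <-> P x.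
Proof. by rewrite inE. Qed.

End Of.

Definition submod_lt X Y := {subset X <= Y} /\ exists2 y, y \in Y & y \notin X.

Lemma submod_ltPn X Y : {subset X <= Y} -> ~ submod_lt X Y -> X = Y.
Proof.
move=> sXY nXY; apply: submod_ext => y; apply/idP/idP; first exact: sXY.
by move=> yY; apply/negPn/negP => yX; apply: nXY; split=> //; exists y.
Qed.

Definition noetherian : Prop :=
  forall N : nat -> submod M,
    (forall k, {subset N k <= N k.+1}) ->
    exists m, forall k, (m <= k)%N -> N k =i N m.

Definition fg_sub X : Prop :=
  exists (T : finType) (g : T -> M), (forall t, g t \in X) /\
    forall x, x \in X -> exists c : T -> R, x = \sum_t c t *: g t.

Section Span.
Variables (T : finType) (g : T -> M).

Fact span_of0 : exists c : T -> R, 0 = \sum_t c t *: g t.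
Proof. by exists (fun=> 0); rewrite big1 // => t _; rewrite scale0r. Qed.

Fact span_ofD a x y : (exists c : T -> R, x = \sum_t c t *: g t) ->
  (exists c : T -> R, y = \sum_t c t *: g t) ->
  exists c : T -> R, a *: x + y = \sum_t c t *: g t.
Proof.
move=> [c ->] [c' ->]; exists (fun t => a * c t + c' t).
rewrite scaler_sumr -big_split; apply: eq_bigr => t _.
by rewrite scalerA scalerDl.
Qed.

Definition span_of : submod M := submod_of span_of0 span_ofD.

Lemma mem_span_of t : g t \in span_of.
Proof.
apply/submod_ofE; exists (fun s => (s == t)%:R).
rewrite (bigD1 t) //= eqxx scale1r big1 ?addr0 // => s /negPf ->.
by rewrite scale0r.
Qed.

End Span.

Lemma submod_sum_mem X (T : Type) (s : seq T) (P : pred T) (c : T -> M) :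
  (forall t, P t -> c t \in X) -> \sum_(t <- s | P t) c t \in X.
Proof. by move=> cX; apply: rpred_sum => t; exact: cX. Qed.

End Submod.

Section WellFounded.
Variables (T : Type) (lt : T -> T -> Prop).
Hypothesis nochain : forall f : nat -> T, exists k, ~ lt (f k.+1) (f k).

(** Without a minimal element, choice would yield a map sending each element of [P] to a smaller
    one, and its iterates would form a forbidden chain. *)
Lemma nochain_min (P : T -> Prop) x0 : P x0 ->
  exists x, P x /\ forall y, P y -> ~ lt y x.
Proof.
move=> Px0; apply: contrapT => nomin.
have next (x : {x | P x}) : exists y : {x | P x}, lt (sval y) (sval x).
  apply: contrapT => nx; apply: nomin; exists (sval x).
  split=> [|y Py ltyx]; first exact: svalP.
  by apply: nx; exists (exist _ y Py).
have [f fP] := choice next.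
have [k] := nochain (fun k => sval (iter k f (exist _ x0 Px0))).
by case; exact: fP.
Qed.

End WellFounded.

Section Chains.
Variables (R : pzRingType) (M : lmodType R).

Lemma artinian_min (P : submod M -> Prop) X0 : artinian M -> P X0 ->
  exists X, P X /\ forall Y, P Y -> ~ submod_lt Y X.
Proof.
move=> artM; apply: nochain_min => f; apply: contrapT => nf.
have lt k : submod_lt (f k.+1) (f k) by apply: contrapT => n; apply: nf; exists k.
have [m fm] := artM f (fun k => (lt k).1).
by have [_ [y yf]] := lt m; rewrite fm ?yf.
Qed.

Lemma noetherian_max (P : submod M -> Prop) X0 : noetherian M -> P X0 ->
  exists X, P X /\ forall Y, P Y -> ~ submod_lt X Y.
Proof.
move=> noeM; apply: (nochain_min (lt := fun X Y => submod_lt Y X)) => f.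
apply: contrapT => nf.
have lt k : submod_lt (f k) (f k.+1) by apply: contrapT => n; apply: nf; exists k.
have [m fm] := noeM f (fun k => (lt k).1).
by have [_ [y]] := lt m; rewrite fm // => ->.
Qed.

Lemma chain_sub_leq (N : nat -> submod M) :
  (forall k, {subset N k <= N k.+1}) ->
  forall m k, (m <= k)%N -> {subset N m <= N k}.
Proof.
move=> incN m k /subnKC <-; elim: (k - m)%N => [|p IH] x xN; first by rewrite addn0.
by rewrite addnS; apply: incN; exact: IH.
Qed.

Lemma chain_sup_leq (N : nat -> submod M) :
  (forall k, {subset N k.+1 <= N k}) ->
  forall m k, (m <= k)%N -> {subset N k <= N m}.
Proof.
move=> decN m k /subnKC <-; elim: (k - m)%N => [|p IH] x; first by rewrite addn0.
by rewrite addnS => /decN; exact: IH.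
Qed.

Lemma fg_noetherian : (forall X : submod M, fg_sub X) -> noetherian M.
Proof.
move=> fgM N incN; have incN' := chain_sub_leq incN.
pose U := @submod_of R M (fun x => exists k, x \in N k).
have U0 : exists k, 0 \in N k by exists 0%N; exact: rpred0.
have UD a x y : (exists k, x \in N k) -> (exists k, y \in N k) ->
    exists k, a *: x + y \in N k.
  move=> [i xi] [j yj]; exists (maxn i j).
  by rewrite rpredD ?rpredZ // (incN' _ _ _ _ xi, incN' _ _ _ _ yj) ?leq_max ?leqnn ?orbT.
have [T [g [gU genU]]] := fgM (U U0 UD).
have gU' t : exists k, g t \in N k by have /submod_ofE := gU t.
have [k kP] := choice gU'.
exists (\max_t k t)%N => m lem x; apply/idP/idP => [xm|]; last exact: incN'.
have : x \in U U0 UD by apply/submod_ofE; exists m.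
move=> /genU[c ->]; apply: submod_sum_mem => t _; apply: rpredZ.
by apply: incN' (kP t); exact: leq_bigmax.
Qed.

(** A maximal submodule among those spanned by finitely many elements of [G] absorbs every further
    one. Drawing the generators from [G] itself keeps a prescribed shape, later [g * e l = g]. *)
Lemma noetherian_finite_gen (G : M -> Prop) : noetherian M ->
  exists (T : finType) (g : T -> M), (forall t, G (g t)) /\
    forall x, G x -> x \in span_of g.
Proof.
move=> noeM.
pose P X := exists (T : finType) (g : T -> M), (forall t, G (g t)) /\ X = span_of g.
have P0 : P (span_of (fun t : void => match t with end)).
  by exists void, (fun t : void => match t with end); split=> // -[].
have [X [[T [g [Gg ->]]] maxX]] := noetherian_max noeM P0.
exists T, g; split=> // x Gx; apply/negPn/negP => xX.
pose g' (t : option T) := if t is Some t then g t else x.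
apply: (maxX (span_of g')).
  by exists (option T), g'; split=> // -[t|] //=; exact: Gg.
split; last by exists x => //; exact: (mem_span_of g' None).
move=> y /submod_ofE[c ->]; apply: submod_sum_mem => t _; apply: rpredZ.
exact: (mem_span_of g' (Some t)).
Qed.

Lemma noetherian_fg_sub (X : submod M) : noetherian M -> fg_sub X.
Proof.
move=> noeM; have [T [g [gX gen]]] := noetherian_finite_gen (fun x => x \in X) noeM.
by exists T, g; split=> // x /gen/submod_ofE.
Qed.

End Chains.

(** * Leading coefficients and chain conditions on finitely generated modules *)

Section Leading.
Variables (R : pzRingType) (M : lmodType R) (m : nat) (g : 'I_m -> M).
Implicit Types X Y : submod M.

(** The leading coefficients at [g j] of elements of [X], as in Hilbert's basis theorem. They are
    not unique for a given element, since the [g i] may be dependent. *)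
Definition lead_spec (j : 'I_m) X (c : R^o) :=
  exists b : 'I_m -> R, [/\ \sum_i b i *: g i \in X,
    (forall i : 'I_m, (j < i)%N -> b i = 0) & b j = c].

Fact lead_spec0 j X : lead_spec j X 0.
Proof.
by exists (fun=> 0); split=> //; rewrite big1 ?rpred0 // => i _; rewrite scale0r.
Qed.

Fact lead_specD j X (a : R) (x y : R^o) :
  lead_spec j X x -> lead_spec j X y -> lead_spec j X (a *: x + y).
Proof.
move=> [b [bX b0 <-]] [b' [b'X b'0 <-]]; exists (fun i => a * b i + b' i).
split=> [|i ji|//]; last by rewrite b0 ?b'0 // mulr0 addr0.
have -> : \sum_i (a * b i + b' i) *: g i
    = a *: (\sum_i b i *: g i) + \sum_i b' i *: g i.
  rewrite scaler_sumr -big_split; apply: eq_bigr => t _.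
  by rewrite scalerA scalerDl.
by rewrite rpredD ?rpredZ.
Qed.

Definition lead_ideal j X : submod R^o :=
  submod_of (@lead_spec0 j X) (@lead_specD j X).

Lemma lead_ideal_mono j X Y :
  {subset X <= Y} -> {subset lead_ideal j X <= lead_ideal j Y}.
Proof.
move=> sXY c /submod_ofE[b [bX b0 bj]]; apply/submod_ofE; exists b.
by split=> //; exact: sXY.
Qed.

Hypothesis gen : forall x, exists c : 'I_m -> R, x = \sum_i c i *: g i.

(** An element of [Y] loses its leading term when an element of [X] with the same leading
    coefficient is subtracted, and the rest is again in [Y]. So the [m] ideals separate nested
    submodules, and chain conditions pass from the ring to [M]. *)
Lemma lead_ideal_inj X Y : {subset X <= Y} ->
  (forall j, {subset lead_ideal j Y <= lead_ideal j X}) -> X =i Y.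
Proof.
move=> sXY sYX x; apply/idP/idP => [/sXY //|].
suff peel p (b : 'I_m -> R) : (forall i : 'I_m, (p <= i)%N -> b i = 0) ->
    \sum_i b i *: g i \in Y -> \sum_i b i *: g i \in X.
  have [c ->] := gen x; apply: (peel m) => i.
  by rewrite leqNgt ltn_ord.
elim: p b => [|p IH] b b0 bY.
  by rewrite big1 ?rpred0 // => i _; rewrite b0 ?scale0r.
have [ltpm|lemp] := ltnP p m; last first.
  apply: IH => // i; rewrite leq_eqVlt => /orP[/eqP ip|]; last exact: b0.
  by move: lemp; rewrite ip leqNgt ltn_ord.
pose j := Ordinal ltpm.
have : (b j : R^o) \in lead_ideal j Y by apply/submod_ofE; exists b; split.
move=> /sYX/submod_ofE[b' [b'X b'0 b'j]].
have E : \sum_i b i *: g i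
    = \sum_i (b i - b' i) *: g i + \sum_i b' i *: g i.
  by rewrite -big_split /=; apply: eq_bigr => i _; rewrite -scalerDl subrK.
rewrite E rpredD //; apply: IH => [i|].
  rewrite leq_eqVlt => /orP[/eqP ip|ltpi]; last by rewrite b0 ?b'0 ?subr0.
  by have -> : i = j; [exact: val_inj | rewrite b'j subrr].
have := bY; rewrite {1}E => bY'.
by rewrite -[X in X \in _](addrK (\sum_i b' i *: g i)) rpredB // sXY.
Qed.

Let stab_all (P : 'I_m -> nat -> Prop) :
  (forall j, exists p, forall k, (p <= k)%N -> P j k) ->
  exists p, forall j k, (p <= k)%N -> P j k.
Proof.
move=> /choice[p pP]; exists (\max_j p j)%N => j k lek; apply: pP.
by apply: leq_trans lek; exact: leq_bigmax.
Qed.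

Lemma fg_module_artinian : artinian R^o -> artinian M.
Proof.
move=> artR N decN; have decN' := chain_sup_leq decN.
have [j|p pP] := stab_all (P := fun j k => forall q, (k <= q)%N ->
    lead_ideal j (N q) =i lead_ideal j (N k)).
  have [p pP] := artR (fun k => lead_ideal j (N k)) (fun k => lead_ideal_mono (@decN k)).
  by exists p => k lepk q lekq x; rewrite !pP // (leq_trans lepk).
exists p => k lepk; apply: lead_ideal_inj; first exact: decN'.
by move=> j c; rewrite (pP j p (leqnn p) k lepk).
Qed.

Lemma fg_module_noetherian : noetherian R^o -> noetherian M.
Proof.
move=> noeR N incN; have incN' := chain_sub_leq incN.
have [j|p pP] := stab_all (P := fun j k => forall q, (k <= q)%N ->
    lead_ideal j (N q) =i lead_ideal j (N k)).
  have [p pP] := noeR (fun k => lead_ideal j (N k)) (fun k => lead_ideal_mono (@incN k)).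
  by exists p => k lepk q lekq x; rewrite !pP // (leq_trans lepk).
exists p => k lepk x; apply/esym/lead_ideal_inj; first exact: incN'.
by move=> j c; rewrite (pP j p (leqnn p) k lepk).
Qed.

End Leading.

(** * Commutative artinian rings are noetherian *)

Section MaximalAvoiding.
Variables (R : pzRingType) (M : lmodType R) (X : submod M) (x : M).
Local Open Scope classical_set_scope.

Lemma submod_maximal_avoiding : x != 0 ->
  exists Y : submod M, [/\ {subset Y <= X}, x \notin Y &
    forall Z : submod M, {subset Z <= X} -> {subset Y <= Z} ->
      x \notin Z -> {subset Z <= Y}].
Proof.
move=> x0.
pose P (Y : set M) := [/\ Y `<=` [set` X], ~ Y x &
  forall a u v, Y u -> Y v -> Y (a *: u + v)].
have [F FP totF|Y [[YX nYx YD] maxY]] := @Zorn_bigcup M P.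
  split=> [y [B /FP[BX _ _]]|[B /FP[_ + _]]|a u v [B FB Bu] [C FC Cv]] //.
    exact: BX.
  have [BC|CB] := totF _ _ FB FC.
    by exists C => //; have [_ _ CD] := FP _ FC; apply: CD => //; exact: BC.
  by exists B => //; have [_ _ BD] := FP _ FB; apply: BD => //; exact: CB.
have maxY' (Z : submod M) : {subset Z <= X} -> (forall y, Y y -> y \in Z) ->
    x \notin Z -> forall z, z \in Z -> Y z.
  move=> ZX YZ nZx z zZ; apply: contrapT => nYz.
  apply: (maxY [set` Z]).
    by split=> [y /YZ|/(_ z zZ)].
  by split=> [y /ZX||a u v uZ vZ] //=; [exact/negP | rewrite rpredD ?rpredZ].
(* [P] does not demand [0], so that the union of the empty chain satisfies it. If [0] were missing,
   [Y] would be empty, because [-1 *: y + y = 0], and the zero submodule would be larger. *)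
have Y0 : Y 0.
  apply: contrapT => nY0; apply: (nY0).
  have sub0 z : z \in span_of (fun t : void => match t return M with end) -> z = 0.
    by move=> /submod_ofE[c ->]; rewrite big1 // => -[].
  apply: maxY' (rpred0 _) => [z /sub0 ->|y Yy|]; first exact: rpred0.
    by case: nY0; rewrite -(addNr y) -scaleN1r; exact: YD.
  by apply: contra_neqN x0 => /sub0.
exists (submod_of Y0 YD); split=> [y /submod_ofE/YX //||Z ZX YZ nZx z zZ].
  by apply/negP => /submod_ofE.
apply/submod_ofE; apply: maxY' zZ => // y Yy; apply: YZ; exact/submod_ofE.
Qed.

End MaximalAvoiding.

Section Akizuki.
Variable k : comNzRingType.
Implicit Types X : submod k^o.

Fact smul_sub0 (r : k) X : exists2 x : k^o, x \in X & 0 = r *: x.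
Proof. by exists 0; rewrite ?rpred0 ?scaler0. Qed.

Fact smul_subD (r : k) X a (u v : k^o) :
  (exists2 x : k^o, x \in X & u = r *: x) ->
  (exists2 x : k^o, x \in X & v = r *: x) ->
  exists2 x : k^o, x \in X & a *: u + v = r *: x.
Proof.
move=> [x xX ->] [y yX ->]; exists (a *: x + y); first by rewrite rpredD ?rpredZ.
by rewrite scalerDr !scalerA mulrC.
Qed.

Definition smul_sub (r : k) X := submod_of (smul_sub0 r X) (@smul_subD r X).

Fact ann_sub0 (r : k) X : (0 : k^o) \in X /\ r *: (0 : k^o) = 0.
Proof. by rewrite rpred0 scaler0. Qed.

Fact ann_subD (r : k) X a (u v : k^o) : u \in X /\ r *: u = 0 ->
  v \in X /\ r *: v = 0 -> a *: u + v \in X /\ r *: (a *: u + v) = 0.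
Proof.
move=> [uX ru] [vX rv]; split; first by rewrite rpredD ?rpredZ.
by rewrite scalerDr rv addr0 scalerA mulrC -scalerA ru scaler0.
Qed.

Definition ann_sub (r : k) X := submod_of (ann_sub0 r X) (@ann_subD r X).

(** Multiplication by [r] maps [X] onto [r X] with kernel [ann_sub r X]; lifted generators of the
    image together with generators of the kernel generate [X]. *)
Lemma fg_smul_ann (r : k) X :
  fg_sub (smul_sub r X) -> fg_sub (ann_sub r X) -> fg_sub X.
Proof.
move=> [T [g [gX gen]]] [T' [g' [g'X gen']]].
have /choice[h hP] t : exists x : k^o, x \in X /\ g t = r *: x.
  by have /submod_ofE[x] := gX t; exists x.
have g'X' t : g' t \in X by have /submod_ofE[] := g'X t.
exists (T + T')%type, (fun t => match t with inl t => h t | inr t => g' t end).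
split=> [[t|t]|x xX] //; first by have [] := hP t.
have /gen[c rx] : r *: x \in smul_sub r X by apply/submod_ofE; exists x.
have /gen'[c' Ec'] : x - \sum_t c t *: h t \in ann_sub r X.
  apply/submod_ofE; split.
    by rewrite rpredB // submod_sum_mem // => t _; rewrite rpredZ //; have [] := hP t.
  rewrite scalerBr rx scaler_sumr -sumrB big1 // => t _.
  by have [_ ->] := hP t; rewrite !scalerA mulrC subrr.
exists (fun t => match t with inl t => c t | inr t => c' t end).
by rewrite big_sumType /= -Ec' addrC subrK.
Qed.

(* A minimal ideal X that is not finitely generated satisfies rX = 0 or rX = X
   for every r, so it is a vector space over the field k/ann(X); a complement in
   it of a line is a proper subspace, hence finitely generated. *)
Theorem comm_artinian_noetherian : artinian k^o -> noetherian k^o.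
Proof.
move=> artk; apply: fg_noetherian => X0; apply: contrapT => nfgX0.
have [X [nfgX minX]] :=
  @artinian_min _ _ (fun X => ~ fg_sub X) X0 artk nfgX0.
have fg_lt Y : submod_lt Y X -> fg_sub Y.
  by move=> ltYX; apply: contrapT => /minX.
have smulP r : (forall x, x \in X -> r *: x = 0) \/
    (forall x, x \in X -> exists2 y, y \in X & x = r *: y).
  have sX : {subset smul_sub r X <= X}.
    by move=> x /submod_ofE[y yX ->]; rewrite rpredZ.
  have aX : {subset ann_sub r X <= X} by move=> x /submod_ofE[].
  case: (pselect (submod_lt (smul_sub r X) X)) => [ltX|nltX].
    case: (pselect (submod_lt (ann_sub r X) X)) => [lt'X|nlt'X].
      by case: nfgX; exact: fg_smul_ann (fg_lt _ ltX) (fg_lt _ lt'X).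
    by left=> x; rewrite -(submod_ltPn aX nlt'X) => /submod_ofE[].
  right=> x; rewrite -{1}(submod_ltPn sX nltX); exact: (submod_ofE _ _ _).1.
(* The descending ideals [(r ^+ n)] become stationary, so [r ^+ m = s * r ^+ m.+1] for some [s]. As
   [r X = X], every element of [X] has the form [r ^+ m *: y] and is therefore fixed by [r * s]. *)
have fieldP r : ~ (forall x, x \in X -> r *: x = 0) ->
    exists s, forall x, x \in X -> x = (r * s) *: x.
  move=> nr0; have {}smulP x : x \in X -> exists2 y, y \in X & x = r *: y.
    by case: (smulP r) => // + xX; apply.
  have rX n x : x \in X -> exists2 y, y \in X & x = r ^+ n *: y.
    elim: n x => [|n IH] x xX; first by exists x; rewrite ?expr0 ?scale1r.
    have [y yX ->] := smulP x xX; have [z zX ->] := IH y yX.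
    by exists z => //; rewrite scalerA exprS.
  pose N n := span_of (fun _ : unit => r ^+ n : k^o).
  have NE n (x : k^o) : (x \in N n) <-> exists c, x = c * r ^+ n.
    split=> [/submod_ofE[c]|[c ->]].
      by rewrite (big_pred1 tt) => [->|[]//]; exists (c tt).
    by apply: (rpredZ c); exact: (mem_span_of _ tt).
  have [|m mP] := artk N.
    move=> n x /NE[c ->]; apply/NE; exists (c * r).
    by rewrite exprS mulrA.
  have : (r ^+ m : k^o) \in N m by apply/NE; exists 1; rewrite mul1r.
  rewrite -(mP m.+1) // => /NE[s rm]; exists s => x /(rX m)[y yX ->].
  rewrite scalerA; congr (_ *: _).
  by rewrite {1}rm exprS mulrA [s * r]mulrC.
have [x xX x0] : exists2 x, x \in X & x != 0.
  apply: contrapT => nX; apply: nfgX; exists void, (fun t : void => match t with end).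
  split=> [[]|x xX]; exists (fun=> 0); rewrite big1 => [|[]//].
  by apply/eqP/negPn/negP => x0; apply: nX; exists x.
have [Y [YX nYx maxY]] := submod_maximal_avoiding X x0.
have [T [g [gY gen]]] : fg_sub Y by apply: fg_lt; split=> //; exists x.
apply: nfgX; exists (T + unit)%type, (fun t => if t is inl t then g t else x).
split=> [[t|[]]|z zX] //; first exact/YX.
suff [a ya] : exists a, z - a *: x \in Y.
  have [c Ec] := gen _ ya.
  exists (fun t => if t is inl t then c t else a).
  by rewrite big_sumType /= -Ec [X in _ + X](big_pred1 tt) ?subrK => [|[]].
case: (boolP (z \in Y)) => [zY|nYz]; first by exists 0; rewrite scale0r subr0.
(* [Zp] describes [Y + k z], which contains [x] by maximality of [Y], say [x - b *: z \in Y]. Since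
   [x \notin Y], [b] does not kill [X], and an inverse of [b] on [X] expresses [z] through [x]
   modulo [Y]. *)
pose Zp (u : k^o) := exists b, u - b *: z \in Y.
have Zp0 : Zp 0 by exists 0; rewrite scale0r subr0 rpred0.
have ZpD a u v : Zp u -> Zp v -> Zp (a *: u + v).
  move=> [b ub] [b' vb']; exists (a * b + b').
  rewrite scalerDl -scalerA opprD addrACA -scalerBr.
  by rewrite rpredD ?rpredZ.
have [b xb] : Zp x.
  apply: contrapT => nxZ; move/negP: nYz; apply.
  apply: (maxY (submod_of Zp0 ZpD)) => [u /submod_ofE[b ub]|u uY||].
  - by rewrite -[u](subrK (b *: z)) rpredD ?rpredZ //; exact: YX.
  - by apply/submod_ofE; exists 0; rewrite scale0r subr0.
  - by apply/negP => /submod_ofE.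
  - by apply/submod_ofE; exists 1; rewrite scale1r subrr rpred0.
case: (pselect (forall x, x \in X -> b *: x = 0)) => [b0|/fieldP[s sP]].
  by move: xb nYx; rewrite b0 // subr0 => ->.
exists s; rewrite -rpredN opprB (sP z zX) mulrC -scalerA -scalerBr.
exact: rpredZ.
Qed.

End Akizuki.

Lemma artin_algebra_artinian (k : comNzRingType) (A : algType k) :
  artin_algebra A -> artinian (A : lmodType k).
Proof. by move=> [artk [m [g gen]]]; exact: fg_module_artinian gen artk. Qed.

Lemma artin_algebra_noetherian (k : comNzRingType) (A : algType k) :
  artin_algebra A -> noetherian (A : lmodType k).
Proof.
move=> [/comm_artinian_noetherian noek [m [g gen]]].
exact: fg_module_noetherian gen noek.
Qed.

(** * Quotients, composition series and dual bases *)

Section Isomorphisms.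
Variable R : pzRingType.
Implicit Types M N P : lmodType R.

Definition linear_of M N (f : M -> N) (linf : linear f) : {linear M -> N} :=
  HB.pack f (GRing.isLinear.Build R M N *:%R f linf).

Lemma isomorphic_sym M N : isomorphic M N -> isomorphic N M.
Proof.
move=> [f [g fK gK]].
have ling : linear g by move=> a x y; apply: (can_inj fK); rewrite linearP !gK.
by exists (linear_of ling), f.
Qed.

Lemma isomorphic_trans N M P :
  isomorphic M N -> isomorphic N P -> isomorphic M P.
Proof.
move=> [f bijf] [g bijg]; exists (linear_of (linearP (g \o f))).
exact: bij_comp.
Qed.

Lemma quomodule_piZ M (K : submod M) a (x : M) :
  quomodule_pi K (a *: x) = a *: quomodule_pi K x.
Proof. exact/esym/quomodule_scaleE. Qed.

Lemma quomodule_pi_eq0 M (K : submod M) (x : M) :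
  quomodule_pi K x = 0 <-> x \in K.
Proof.
have -> : (0 : quomodule K) = quomodule_pi K 0.
  by rewrite -[X in quomodule_pi _ X](subrr 0) quomodule_piB subrr.
by rewrite -[X in X \in _]subr0 -quomodule_eq; split=> /eqP.
Qed.

Lemma quomodule_iso M N (f : {linear M -> N}) (K : submod M) :
  surjective f -> (forall x, x \in K <-> f x = 0) ->
  isomorphic (quomodule K) N.
Proof.
move=> surjf kerf; pose g (q : quomodule K) := f (repr (q : Quotient.quot K)).
have gE x : g (quomodule_pi K x) = f x.
  apply/eqP; rewrite -subr_eq0 -linearB; apply/eqP/kerf.
  by rewrite -quomodule_eq quomodule_repr.
have ling : linear g.
  move=> a x y; rewrite -[x]quomodule_repr -[y]quomodule_repr.
  by rewrite -quomodule_piZ -quomodule_piD !gE linearP.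
exists (linear_of ling); have [h hK] := choice surjf.
exists (fun y => quomodule_pi K (h y)) => [q|y] /=; last by rewrite gE hK.
rewrite -[in RHS](quomodule_repr q); apply/eqP; rewrite quomodule_eq.
by apply/kerf; rewrite linearB hK subrr.
Qed.

Fact ker0 M N (f : {linear M -> N}) : f 0 = 0.
Proof. exact: linear0. Qed.

Fact kerD M N (f : {linear M -> N}) a x y :
  f x = 0 -> f y = 0 -> f (a *: x + y) = 0.
Proof. by move=> fx fy; rewrite linearP fx fy scaler0 addr0. Qed.

Lemma isomorphic_same_ker M N P (f : {linear P -> M}) (g : {linear P -> N}) :
  surjective f -> surjective g -> (forall x, f x = 0 <-> g x = 0) ->
  isomorphic M N.
Proof.
move=> surjf surjg fg; pose K := submod_of (ker0 f) (@kerD _ _ f).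
apply: (@isomorphic_trans (quomodule K)).
  by apply/isomorphic_sym/(quomodule_iso surjf) => x; exact: submod_ofE.
apply: (quomodule_iso surjg) => x; rewrite -fg; exact: submod_ofE.
Qed.

End Isomorphisms.

Section Subquotients.
Variables (R : pzRingType) (M : lmodType R) (X Y : submod M).

Definition subquo_pi (u : submodule X) : subquo X Y :=
  quomodule_pi (Submod (trace_closed X Y)) u.

Lemma subquo_piP (q : subquo X Y) : exists u, q = subquo_pi u.
Proof. by exists (repr (q : Quotient.quot _)); rewrite -[LHS]quomodule_repr. Qed.

Lemma subquo_pi_linear : linear subquo_pi.
Proof. by move=> a u v; rewrite -quomodule_piZ -quomodule_piD. Qed.

Lemma subquo_pi_eq0 u : subquo_pi u = 0 <-> val u \in Y.
Proof. exact: (quomodule_pi_eq0 (Submod (trace_closed X Y)) u). Qed.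

Fact subquo_preim0 (V : submod (subquo X Y)) :
  exists2 u : submodule X, val u = 0 & subquo_pi u \in V.
Proof.
by exists 0 => //; have -> : subquo_pi 0 = 0; [exact/subquo_pi_eq0/rpred0 | exact: rpred0].
Qed.

Fact subquo_preimD (V : submod (subquo X Y)) a x y :
  (exists2 u : submodule X, val u = x & subquo_pi u \in V) ->
  (exists2 u : submodule X, val u = y & subquo_pi u \in V) ->
  exists2 u : submodule X, val u = a *: x + y & subquo_pi u \in V.
Proof.
move=> [u <- uV] [v <- vV]; exists (a *: u + v) => //.
by rewrite subquo_pi_linear rpredD ?rpredZ.
Qed.

Definition subquo_preim V := submod_of (subquo_preim0 V) (@subquo_preimD V).

Lemma subquo_simple : submod_lt Y X ->
  (forall Z : submod M, submod_lt Y Z -> ~ submod_lt Z X) ->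
  simple_module (subquo X Y).
Proof.
move=> [YX [x xX nYx]] between; split.
  exists (subquo_pi (SubmoduleElt xX)); apply/eqP => /subquo_pi_eq0 /=.
  exact/negP.
move=> V; pose Z := subquo_preim V.
have YZ : {subset Y <= Z}.
  move=> y yY; apply/submod_ofE; exists (SubmoduleElt (YX _ yY)) => //.
  by have -> : subquo_pi (SubmoduleElt (YX _ yY)) = 0;
    [exact/subquo_pi_eq0 | exact: rpred0].
have ZX : {subset Z <= X} by move=> z /submod_ofE[u <- _]; exact: valP.
case: (pselect (submod_lt Y Z)) => [ltYZ|nltYZ]; last left=> q.
  right=> q; have [u ->] := subquo_piP q.
  have : val u \in Z by rewrite (submod_ltPn ZX (between _ ltYZ)); exact: valP.
  by move=> /submod_ofE[v /val_inj <-].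
have [u ->] := subquo_piP q => uV; apply/subquo_pi_eq0.
by rewrite (submod_ltPn YZ nltYZ); apply/submod_ofE; exists u.
Qed.

End Subquotients.

(** * Chains of submodules and composition series *)

Section Steps.
Variables (R : pzRingType) (M : lmodType R) (step : submod M -> submod M -> Prop).

(** The reflexive transitive closure of [step], indexed as in [filtration] so that a path can be
    read off as a filtration. *)
Definition steps X Y := exists l (N : nat -> submod M),
  [/\ N 0%N = X, N l = Y & forall k, (k < l)%N -> step (N k) (N k.+1)].

Lemma steps_refl X : steps X X.
Proof. by exists 0%N, (fun=> X). Qed.

Lemma steps_cons Y X Z : step X Y -> steps Y Z -> steps X Z.
Proof.
move=> sXY [l [N [N0 Nl sN]]]; exists l.+1, (fun k => if k is k.+1 then N k else X).
by split=> // -[|k] ltkl; [rewrite N0 | exact: sN].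
Qed.

Lemma steps_trans Y X Z : steps X Y -> steps Y Z -> steps X Z.
Proof.
move=> [l [N [<- <- {X Y}]]]; elim: l N => [|l IH] N //= sN sZ.
apply: (@steps_cons (N 1%N)); first exact: sN.
by apply: (IH (fun k => N k.+1)) => // k ltkl; exact: sN.
Qed.

Lemma steps1 X Y : step X Y -> steps X Y.
Proof. by move=> sXY; apply: steps_cons sXY (steps_refl _). Qed.

End Steps.

Section CompositionSeries.
Variables (R : pzRingType) (M : lmodType R).

(** A minimal submodule reachable from [M] by simple steps is zero: otherwise it has a maximal
    proper submodule, which is one simple step further. *)
Lemma exists_composition_series : artinian M -> noetherian M ->
  exists l N, @composition_series R M l N.
Proof.
move=> artM noeM.
pose step (X Y : submod M) := {subset Y <= X} /\ simple_module (subquo X Y).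
have top0 : True by [].
pose top := @submod_of R M (fun=> True) top0 (fun _ _ _ _ _ => top0).
have [X [topX minX]] := artinian_min artM (steps_refl step top).
have X0 x : x \in X -> x = 0.
  move=> xX; apply: contrapT => x0.
  pose zero := span_of (fun t : void => match t return M with end).
  have zero0 z : z \in zero -> z = 0.
    by move=> /submod_ofE[c ->]; rewrite big1 // => -[].
  have [|Y [ltYX maxY]] := @noetherian_max _ _ (fun Y => submod_lt Y X) zero noeM.
    split=> [z /zero0 -> //|]; first exact: rpred0.
    by exists x => //; apply/negP => /zero0.
  apply: (minX Y) => //; apply: steps_trans topX (steps1 _); split; first by case: ltYX.
  by apply: subquo_simple => // Z ltYZ /maxY.
have [l [N [N0 Nl sN]]] := topX; exists l, N; split; last by move=> k /sN[].
split=> [x|x|k /sN[] //]; first by rewrite N0; exact/submod_ofE.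
by rewrite Nl; exact: X0.
Qed.

End CompositionSeries.

Section Transfer.
Variables (R R' : pzRingType) (M : lmodType R) (N : lmodType R').
Variable F : submod N -> submod M.
Hypotheses (Fmono : forall X Y : submod N, {subset X <= Y} -> {subset F X <= F Y})
  (Finj : forall X Y : submod N, F X =i F Y -> X =i Y).

(** A chain is stationary as soon as its image under the monotone injective [F] is. The two rings
    may differ, which covers restriction of scalars to [k] and passage to a quotient ring. *)
Lemma artinian_transfer : artinian M -> artinian N.
Proof.
move=> artM U decU; have [m mP] := artM (F \o U) (fun k => Fmono (decU k)).
by exists m => k /mP/Finj.
Qed.

Lemma noetherian_transfer : noetherian M -> noetherian N.
Proof.
move=> noeM U incU; have [m mP] := noeM (F \o U) (fun k => Fmono (incU k)).
by exists m => k /mP/Finj.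
Qed.

End Transfer.

Section Quotient.
Variables (R : pzRingType) (M N : lmodType R) (f : {linear M -> N}).
Hypothesis surjf : surjective f.

Fact preim0 (X : submod N) : f 0 \in X.
Proof. by rewrite linear0 rpred0. Qed.

Fact preimD (X : submod N) a x y : f x \in X -> f y \in X -> f (a *: x + y) \in X.
Proof. by move=> fx fy; rewrite linearP rpredD ?rpredZ. Qed.

Definition preim_sub X := submod_of (preim0 X) (@preimD X).

Lemma preim_sub_mono (X Y : submod N) : {subset X <= Y} -> {subset preim_sub X <= preim_sub Y}.
Proof. by move=> sXY x /submod_ofE fx; apply/submod_ofE; exact: sXY. Qed.

Lemma preim_sub_inj (X Y : submod N) : preim_sub X =i preim_sub Y -> X =i Y.
Proof.
move=> XY y; have [x <-] := surjf y; apply/idP/idP => fxX.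
  by apply/(submod_ofE (preim0 Y) (@preimD Y)); rewrite -XY; apply/submod_ofE.
by apply/(submod_ofE (preim0 X) (@preimD X)); rewrite XY; apply/submod_ofE.
Qed.

Lemma artinian_quo : artinian M -> artinian N.
Proof. exact: artinian_transfer preim_sub_mono preim_sub_inj. Qed.

Lemma noetherian_quo : noetherian M -> noetherian N.
Proof. exact: noetherian_transfer preim_sub_mono preim_sub_inj. Qed.

End Quotient.

(** * Dual bases and projectivity *)

Section DualBasis.
Variables (R : pzRingType) (M : lmodType R).

(** The generators define a surjection from a free module; the [phi t] are the coordinates of a
    splitting. *)
Lemma projective_dual (T : finType) (g : T -> M) : projective M ->
  (forall x, x \in span_of g) ->
  exists phi : T -> M -> R, (forall t, linear (phi t : M -> R^o)) /\
    forall x, x = \sum_t phi t x *: g t.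
Proof.
move=> projM gen; pose G (c : {ffun T -> R^o}) := \sum_t (c t : R) *: g t.
have linG : linear G.
  move=> a c d; rewrite /G scaler_sumr -big_split; apply: eq_bigr => t _ /=.
  by rewrite !ffunE scalerA scalerDl.
have surjG : surjective (linear_of linG).
  move=> x; have /submod_ofE[c ->] := gen x; exists [ffun t => c t].
  by apply: eq_bigr => t _; rewrite ffunE.
have [h hK] := projM _ _ (linear_of linG) (linear_of (@linearP _ _ _ _ idfun)) surjG.
exists (fun t x => h x t); split=> [t a x y|x]; first by rewrite linearP !ffunE.
exact/esym/hK.
Qed.

Lemma dual_projective (T : finType) (g : T -> M) (phi : T -> M -> R) :
  (forall t, linear (phi t : M -> R^o)) -> (forall x, x = \sum_t phi t x *: g t) ->
  projective M.
Proof.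
move=> linphi phiK U V p f surjp.
have /choice[u uP] t : exists u, p u = f (g t) by exact: surjp.
pose h (x : M) := \sum_t phi t x *: u t.
have linh : linear h.
  move=> a x y; rewrite /h scaler_sumr -big_split; apply: eq_bigr => t _ /=.
  by rewrite linphi scalerDl scalerA.
exists (linear_of linh) => x; rewrite [in RHS](phiK x) /= /h !linear_sum.
by apply: eq_bigr => t _; rewrite !linearZ /= uP.
Qed.

(** Stated for a subset of the ring, with total functions that are linear on [X] only, so that it
    can be moved between module types having the same elements. *)
Definition has_dual_basis (X : {pred R}) : Prop :=
  exists (T : finType) (g : T -> R) (phi : T -> R -> R),
    [/\ forall t, g t \in X,
        forall t a x y, x \in X -> y \in X ->
          phi t (a * x + y) = a * phi t x + phi t y
      & forall x, x \in X -> x = \sum_t phi t x * g t].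

Lemma projective_dual_basis (f : {linear M -> R^o}) (X : submod R^o) :
  injective f -> (forall y, y \in X <-> exists x, f x = y) -> fg_sub X ->
  projective M <-> has_dual_basis X.
Proof.
move=> injf imf [T0 [g0 [g0X gen0]]].
have /choice[r rP] y : exists x, y \in X -> f x = y.
  case: (boolP (y \in X)) => [/imf[x <-]|_]; first by exists x.
  by exists 0.
have rf x : r (f x) = x by apply: injf; apply: rP; apply/imf; exists x.
have rlin (a : R) (x y : R^o) : x \in X -> y \in X ->
    r (a *: x + y) = a *: r x + r y.
  move=> xX yX; apply: injf; rewrite linearP !rP //.
  by rewrite rpredD ?rpredZ.
split=> [projM|[T [g [phi [gX phiD phiK]]]]].
  have [x|phi [linphi phiK]] := projective_dual (g := fun t => r (g0 t)) projM.
    have /gen0[c Ec] : f x \in X by apply/imf; exists x.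
    apply/submod_ofE; exists c; apply: injf; rewrite Ec linear_sum.
    by apply: eq_bigr => t _; rewrite linearZ /= rP.
  exists T0, g0, (fun t y => phi t (r y)); split=> [//|t a x y xX yX|x xX].
    by rewrite (rlin a x y) // linphi.
  rewrite -{1}[x]rP // {1}[r x]phiK linear_sum; apply: eq_bigr => t _.
  by rewrite linearZ /= rP.
apply: (@dual_projective T (fun t => r (g t)) (fun t x => phi t (f x))).
  move=> t a x y; rewrite linearP; apply: phiD; by apply/imf; eexists.
move=> x; apply: injf; rewrite linear_sum {1}[f x]phiK; last by apply/imf; exists x.
by apply: eq_bigr => t _; rewrite linearZ /= rP.
Qed.

End DualBasis.

Lemma projective_submodule (R : pzRingType) (X : submod R^o) :
  noetherian R^o -> projective (submodule X) <-> has_dual_basis X.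
Proof.
move=> noeR.
have linv : linear (val : submodule X -> R^o) by exact: linearP.
apply: (@projective_dual_basis _ _ (linear_of linv)).
- exact: val_inj.
- move=> y; split=> [yX|[x <-]]; last exact: valP.
  by exists (SubmoduleElt yX).
- exact: noetherian_fg_sub.
Qed.

(** * Local idempotents and simple modules *)

Definition ract (A : pzRingType) (M : rmodType A) (x : M) (a : A) : M :=
  (a : A^c) *: x.
Local Notation "x ** a" := (ract x a) (at level 40, left associativity).

Section RightAction.
Variables (A : pzRingType) (M : rmodType A).
Implicit Types (x y : M) (a b : A).

Lemma scale_ract (a : A^c) x : a *: x = x ** a.
Proof. by []. Qed.

Lemma ractA x a b : x ** a ** b = x ** (a * b).
Proof. exact: scalerA. Qed.

Lemma ract1 x : x ** 1 = x.
Proof. exact: scale1r. Qed.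

Lemma ractDl x y a : (x + y) ** a = x ** a + y ** a.
Proof. exact: scalerDr. Qed.

Lemma ractDr x a b : x ** (a + b) = x ** a + x ** b.
Proof. exact: scalerDl. Qed.

Lemma ract0 x : x ** 0 = 0.
Proof. exact: scale0r. Qed.

Lemma ract0l a : (0 : M) ** a = 0.
Proof. exact: scaler0. Qed.

Lemma ractBr x a b : x ** (a - b) = x ** a - x ** b.
Proof. exact: scalerBl. Qed.

Lemma ractBl x y a : (x - y) ** a = x ** a - y ** a.
Proof. exact: scalerBr. Qed.

Lemma mem_ract (X : submod M) x a : x \in X -> x ** a \in X.
Proof. exact: rpredZ. Qed.

Lemma linear_ract (N : rmodType A) (f : {linear M -> N}) x a :
  f (x ** a) = f x ** a.
Proof. exact: linearZ. Qed.

Fact cyclic0 x : exists a, 0 = x ** a.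
Proof. by exists 0; rewrite ract0. Qed.

Fact cyclicD x (a : A^c) y z : (exists b, y = x ** b) -> (exists b, z = x ** b) ->
  exists b, a *: y + z = x ** b.
Proof.
move=> [b ->] [c ->]; exists (b * a + c).
by rewrite ractDr -ractA.
Qed.

Definition cyclic x := submod_of (cyclic0 x) (@cyclicD x).

Lemma simple_cyclic x y : simple_module M -> x != 0 -> exists a, y = x ** a.
Proof.
move=> [_ /(_ (cyclic x))[x0|xM]] nx0; last by have /submod_ofE := xM y.
case/eqP: nx0; apply: x0; apply/submod_ofE; exists 1; by rewrite ract1.
Qed.

Fact gen_sub0 (G : M -> Prop) (Z : submod M) : (forall g, G g -> g \in Z) -> 0 \in Z.
Proof. by move=> _; exact: rpred0. Qed.

Fact gen_subD (G : M -> Prop) (a : A^c) y z :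
  (forall Z : submod M, (forall g, G g -> g \in Z) -> y \in Z) ->
  (forall Z : submod M, (forall g, G g -> g \in Z) -> z \in Z) ->
  forall Z : submod M, (forall g, G g -> g \in Z) -> a *: y + z \in Z.
Proof. by move=> hy hz Z GZ; rewrite rpredD ?rpredZ ?hy ?hz. Qed.

Definition gen_sub (G : M -> Prop) := submod_of (@gen_sub0 G) (@gen_subD G).

Lemma mem_gen_sub (G : M -> Prop) x : G x -> x \in gen_sub G.
Proof. by move=> Gx; apply/submod_ofE => Z; apply. Qed.

Lemma gen_sub_min (G : M -> Prop) (Z : submod M) :
  (forall g, G g -> g \in Z) -> {subset gen_sub G <= Z}.
Proof. by move=> GZ x /submod_ofE; apply. Qed.

End RightAction.

Section Corner.
Variable A : pzRingType.
Implicit Types e x y : A.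

Definition in_corner e x := e * x = x /\ x * e = x.

Definition corner_unit e x := exists y, [/\ in_corner e y, x * y = e & y * x = e].

(* These conditions are invariant under passing to the opposite ring. *)
Record local_idempotents (I : finType) (e : I -> A) : Prop := {
  li_idem : forall i, e i * e i = e i;
  li_neq0 : forall i, e i != 0;
  li_dir : forall i x y, in_corner (e i) x -> in_corner (e i) y ->
    x * y = e i -> y * x = e i;
  li_loc : forall i x, in_corner (e i) x -> ~ corner_unit (e i) x ->
    corner_unit (e i) (e i - x);
  li_orth : forall i j a b, i <> j ->
    ~ corner_unit (e i) (e i * a * e j * b * e i);
  li_full : forall H : ideal A, (forall i, e i \in H) -> forall x, x \in H }.

End Corner.

Section LocalIdempotents.
Variables (A : pzRingType) (I : finType) (e : I -> A).
Hypothesis le : local_idempotents e.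
Let ee := li_idem le.

Lemma in_corner_id i : in_corner (e i) (e i).
Proof. by split; rewrite ee. Qed.

Lemma in_cornerE i a : in_corner (e i) (e i * a * e i).
Proof. by split; rewrite ?mulrA ?ee // -mulrA ee. Qed.

Lemma in_cornerM i x y :
  in_corner (e i) x -> in_corner (e i) y -> in_corner (e i) (x * y).
Proof. by move=> [xl xr] [yl yr]; split; rewrite ?mulrA ?xl // -mulrA yr. Qed.

Lemma in_cornerB i x y :
  in_corner (e i) x -> in_corner (e i) y -> in_corner (e i) (x - y).
Proof. by move=> [xl xr] [yl yr]; split; rewrite (mulrBr, mulrBl) ?xl ?xr ?yl ?yr. Qed.

Lemma in_cornerD i x y :
  in_corner (e i) x -> in_corner (e i) y -> in_corner (e i) (x + y).
Proof. by move=> [xl xr] [yl yr]; split; rewrite (mulrDr, mulrDl) ?xl ?xr ?yl ?yr. Qed.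

Lemma in_corner0 i : in_corner (e i) 0.
Proof. by split; rewrite (mulr0, mul0r). Qed.

Lemma corner_unit_id i : corner_unit (e i) (e i).
Proof. by exists (e i); rewrite ee; split=> //; exact: in_corner_id. Qed.

Lemma corner_unitMl i x y : in_corner (e i) x -> in_corner (e i) y ->
  corner_unit (e i) (x * y) -> corner_unit (e i) x.
Proof.
move=> xe ye [z [ze xyz _]]; have yze := in_cornerM ye ze.
exists (y * z); split=> //; first by rewrite mulrA.
by apply: (li_dir le) => //; rewrite mulrA.
Qed.

Lemma corner_nonunit0 i : ~ corner_unit (e i) 0.
Proof. by move=> [y [_ + _]]; rewrite mul0r => /esym/eqP; apply/negP/(li_neq0 le). Qed.

(** Let [z] be inverse to [x + y]. If [x] is not a unit, neither is [x * z], so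
    [e i - x * z = y * z] is one by locality. *)
Lemma corner_unitD i x y : in_corner (e i) x -> in_corner (e i) y ->
  corner_unit (e i) (x + y) -> corner_unit (e i) x \/ corner_unit (e i) y.
Proof.
move=> xe ye [z [ze xyz _]]; apply: contrapT => /not_orP[nx ny].
have := li_loc le (in_cornerM xe ze) (fun h => nx (corner_unitMl xe ze h)).
have -> : e i - x * z = y * z by rewrite -xyz mulrDl addrC addKr.
by move=> /(corner_unitMl ye ze).
Qed.

Lemma corner_nonunit_sum i (T : Type) (s : seq T) (P : pred T) (F : T -> A) :
  (forall t, P t -> in_corner (e i) (F t) /\ ~ corner_unit (e i) (F t)) ->
  in_corner (e i) (\sum_(t <- s | P t) F t) /\
    ~ corner_unit (e i) (\sum_(t <- s | P t) F t).
Proof.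
move=> FP; elim/big_rec: _ => [|t x Pt [xe nx]].
  by split; [exact: in_corner0 | exact: corner_nonunit0].
have [te nt] := FP t Pt; split; first exact: in_cornerD.
by move=> /(corner_unitD te xe)[].
Qed.

Section Modules.
Variable M : rmodType A.

(** A form of Nakayama's lemma: [m] is killed by [e i - x], which is a unit of the corner. *)
Lemma nonunit_fix0 i x (m : M) : in_corner (e i) x -> ~ corner_unit (e i) x ->
  m ** e i = m -> m = m ** x -> m = 0.
Proof.
move=> xe nx me mx; have [y [_ xy _]] := li_loc le xe nx.
by rewrite -me -xy -ractA ractBr -mx me subrr ract0l.
Qed.

Hypothesis simM : simple_module M.

(** The right-hand side does not mention [M] or [m]. Hence two simple modules on which [e i] acts
    nontrivially are quotients of [e i A] by the same kernel, which is how [simple_iso] obtains an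
    isomorphism. *)
Lemma simple_kernel i (m : M) a : m ** e i = m -> m != 0 ->
  m ** a = 0 <-> forall b, ~ corner_unit (e i) (e i * a * b * e i).
Proof.
move=> me m0; split=> [ma b [y [_ aby _]]|na].
  case/eqP: m0; have -> : m = m ** (e i * a * b * e i * y) by rewrite aby me.
  by rewrite -!ractA me ma !ract0l.
apply: contrapT => /eqP ma0; have [b mb] := simple_cyclic m simM ma0.
case/eqP: m0; apply: (@nonunit_fix0 i (e i * a * b * e i)) => //.
  by rewrite -[_ * b]mulrA; exact: in_cornerE.
by rewrite -!ractA me -mb me.
Qed.

(** The annihilator of [M] is a two-sided ideal; if it contained every [e i], it would contain 1 by
    [li_full]. *)
Lemma simple_full : exists i (m : M), m ** e i != 0.
Proof.
apply: contrapT => nM.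
have {}nM i (m : M) : m ** e i = 0.
  by apply: contrapT => /eqP ?; apply: nM; exists i, m.
pose P (x : A) := forall m : M, m ** x = 0.
have PE x : (x \in [pred x : A | `[< P x >]]) <-> P x by rewrite inE.
have clP : zmod_closed [pred x : A | `[< P x >]].
  split=> [|x y /PE Px /PE Py]; apply/PE => m; first exact: ract0.
  by rewrite ractBr Px Py subrr.
have mull (a x : A) : x \in [pred x : A | `[< P x >]] ->
    a * x \in [pred x : A | `[< P x >]].
  by move=> /PE Px; apply/PE => m; rewrite -ractA Px.
have mulr (a x : A) : x \in [pred x : A | `[< P x >]] ->
    x * a \in [pred x : A | `[< P x >]].
  by move=> /PE Px; apply/PE => m; rewrite -ractA Px ract0l.
have /PE P1 : 1 \in Ideal clP mull mulr by apply: (li_full le) => i; apply/PE => m.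
by have [[x /eqP[]]] := simM; rewrite -(ract1 x) P1.
Qed.

End Modules.

Section Simples.
Variable S : I -> rmodType A.
Hypotheses (simS : forall i, simple_module (S i))
  (topS : forall i, exists s : S i, s ** e i != 0).

Lemma cyclic_map_linear (M : rmodType A) i (m : M) :
  linear (fun v : pright (e i) => m ** (val v : A)).
Proof.
move=> a u v.
by have := ractDr m ((val u : A) * a) (val v : A); rewrite -ractA.
Qed.

Lemma prightP i (v : pright (e i)) : e i * (val v : A) = val v.
Proof.
by have := valP v; rewrite inE => -[a <-]; rewrite mulrA ee.
Qed.

Lemma pright_subproof i a : (e i * a : rreg A) \in Submod (pright_closed (e i)).
Proof. by rewrite inE; exists a. Qed.

Definition pright_elt i a : pright (e i) := SubmoduleElt (pright_subproof i a).

Lemma simple_iso (M : rmodType A) i (m : M) :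
  simple_module M -> m ** e i != 0 -> isomorphic M (S i).
Proof.
move=> simM m0; have [s s0] := topS i.
have surj (N : rmodType A) (n : N) : simple_module N -> n ** e i != 0 ->
    surjective (linear_of (@cyclic_map_linear N i (n ** e i))).
  move=> simN n0 y; have [a ->] := simple_cyclic y simN n0.
  by exists (pright_elt i a); rewrite /= ractA mulrA ee ractA.
apply: isomorphic_same_ker (surj M m simM m0) (surj (S i) s (simS i) s0) _ => v /=.
have eid (N : rmodType A) (n : N) : n ** e i ** e i = n ** e i by rewrite ractA ee.
rewrite (simple_kernel simM (val v : A) (eid _ m) m0).
by rewrite (simple_kernel (simS i) (val v : A) (eid _ s) s0).
Qed.

(** If [e j] acted nontrivially too, simplicity would let a nonzero [t ** e i] return to itself
    through [s ** e j]. It would then be fixed by an element factoring through [e j], which is a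
    non-unit by [li_orth]. *)
Lemma simple_act0 i j (s : S i) : i <> j -> s ** e j = 0.
Proof.
move=> ij; apply: contrapT => /eqP s0; have [t t0] := topS i.
have [a ta] := simple_cyclic (t ** e i) (simS i) s0.
have [b sb] := simple_cyclic (s ** e j) (simS i) t0.
case/eqP: t0; apply: (@nonunit_fix0 _ i (e i * b * e j * a * e i)).
- by split; rewrite ?mulrA ?ee // -mulrA ee.
- exact: (li_orth le).
- by rewrite ractA ee.
by rewrite -!ractA [t ** _ ** _]ractA ee -sb [s ** _ ** _]ractA ee -ta ractA ee.
Qed.
End Simples.
End LocalIdempotents.

(** * The chain of idempotent ideals *)

Lemma mem_gen_ideal (A : pzRingType) (u : A) : u \in gen_ideal u.
Proof.
rewrite inE; exists [:: (u, 1)]; last by rewrite big_seq1 mulr1.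
move=> p; rewrite inE => /eqP -> /=; split=> //.
exists [:: (1, u)]; last by rewrite big_seq1 mul1r.
by move=> q; rewrite inE => /eqP ->.
Qed.

Lemma gen_ideal_ind (A : pzRingType) (u : A) (P : A -> Prop) : P 0 ->
  (forall x y, P x -> P y -> P (x + y)) -> (forall a b, P (a * u * b)) ->
  forall x, x \in gen_ideal u -> P x.
Proof.
move=> P0 PD Pu x; rewrite inE => -[s sP ->].
rewrite big_seq; elim/big_ind: _ => // p /sP[[t tP ->] _].
rewrite mulr_suml big_seq; elim/big_ind: _ => // q /tP[_ ->].
exact: Pu.
Qed.

Section OrderChain.
Variables (A : pzRingType) (d : Order.disp_t) (I : finOrderType d) (e : I -> A).
Implicit Types (i j : I) (m : nat).
Local Notation H := (order_chain e).

(** Positions count from 0: [H (rank i)] is the first ideal of the chain built with [e i] and the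
    higher idempotents, and [H (rank i).+1] uses only those strictly above [i]. *)
Definition rank (i : I) : nat := Order.enum_rank i.

Lemma rank_lt i : (rank i < #|I|)%N.
Proof. exact: ltn_ord. Qed.

Lemma ltErank i j : (i < j)%O = (rank i < rank j)%N.
Proof. by rewrite !ltNge ltnNge -Order.le_enum_rank. Qed.

Lemma eq_or_rank_lt i j : (rank i <= rank j)%N -> j = i \/ (rank i < rank j)%N.
Proof.
rewrite leq_eqVlt => /orP[/eqP ij|]; last by right.
by left; apply/Order.enum_rank_inj/val_inj.
Qed.

Lemma rank_enum_val (k : 'I_#|I|) : rank (Order.enum_val k) = k.
Proof. by rewrite /rank Order.enum_valK. Qed.

Lemma order_chain_ind m (P : A -> Prop) : P 0 ->
  (forall x y, P x -> P y -> P (x + y)) ->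
  (forall a j b, (m <= rank j)%N -> P (a * e j * b)) ->
  forall x, x \in H m -> P x.
Proof.
move=> P0 PD Pe; apply: gen_ideal_ind => // a b.
rewrite mulr_sumr mulr_suml; elim/big_ind: _ => // k lemk.
by apply: Pe; rewrite rank_enum_val.
Qed.

Lemma order_chain_top m x : (#|I| <= m)%N -> x \in H m -> x = 0.
Proof.
move=> lem; move: x; apply: order_chain_ind => // [x y -> ->|a j b lemj].
  by rewrite addr0.
by have := leq_trans lem lemj; rewrite leqNgt rank_lt.
Qed.

Hypothesis le : local_idempotents e.
Let ee := li_idem le.

(** Compressing the generating sum [u] to [e i * u * e i] gives [e i] plus terms factoring through
    other idempotents. Those are non-units, so [e i * u * e i] is a unit of the local corner, and it
    lies in [H m]. *)
Lemma mem_order_chain m i : (m <= rank i)%N -> e i \in H m.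
Proof.
move=> lemi; pose k0 := Order.enum_rank i.
set u := \sum_(k < #|I| | (m <= k)%N) e (Order.enum_val k).
(* The factors [-1] and [1] give the summands the shape demanded by [li_orth]. *)
pose r := \sum_(k < #|I| | (m <= k)%N && (k != k0))
  e i * -1 * e (Order.enum_val k) * 1 * e i.
have eE : e i = e i * u * e i + r.
  rewrite /u (bigD1 k0) //= Order.enum_rankK mulrDr mulrDl !ee -addrA.
  rewrite mulr_sumr mulr_suml -big_split big1 ?addr0 //= => k _.
  by rewrite mulr1 mulrN1 !mulNr subrr.
have [re nr] : in_corner (e i) r /\ ~ corner_unit (e i) r.
  apply: corner_nonunit_sum => // k /andP[_ kk0]; split.
    by split; rewrite ?mulrA ?ee // -mulrA ee.
  apply: (li_orth le) => ik; move/eqP: kk0; apply.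
  by rewrite /k0 ik Order.enum_valK.
have : corner_unit (e i) (e i * u * e i + r).
  by rewrite -eE; exact: corner_unit_id.
move=> /(corner_unitD le (in_cornerE le i u) re)[[y [_ uy _]]|//].
by rewrite -uy; do 2!apply: ideal_mulr; apply: ideal_mull; exact: mem_gen_ideal.
Qed.

Lemma order_chain_sub m m' : (m <= m')%N -> {subset H m' <= H m}.
Proof.
move=> lemm'; apply: order_chain_ind => [|x y|a j b lemj]; first exact: rpred0.
  exact: rpredD.
by apply/ideal_mulr/ideal_mull/mem_order_chain/(leq_trans lemm').
Qed.

Lemma order_chain_bot x : x \in H 0%N.
Proof. by apply: (li_full le) => i; exact: mem_order_chain. Qed.

End OrderChain.

(** * Standard modules *)

Section SubquoAction.
Variables (A : pzRingType) (M : rmodType A) (X Y : submod M).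

Lemma subquo_pi_ract (u : submodule X) (a : A) :
  subquo_pi Y (u ** a) = subquo_pi Y u ** a.
Proof. exact: (linear_ract (linear_of (@subquo_pi_linear _ _ X Y))). Qed.

Lemma subquo_piB (u v : submodule X) :
  subquo_pi Y (u - v) = subquo_pi Y u - subquo_pi Y v.
Proof. exact: (linearB (linear_of (@subquo_pi_linear _ _ X Y))). Qed.

Lemma subquo_act0 (a : A) :
  (forall q : subquo X Y, q ** a = 0) <-> (forall x, x \in X -> x ** a \in Y).
Proof.
split=> [act0 x xX|act0 q].
  have /subquo_pi_eq0 : subquo_pi Y (SubmoduleElt xX ** a) = 0.
    by rewrite subquo_pi_ract act0.
  by [].
have [u ->] := subquo_piP q; rewrite -subquo_pi_ract; apply/subquo_pi_eq0.
by apply: act0; exact: valP.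
Qed.

End SubquoAction.

Lemma isomorphic_act0 (A : pzRingType) (M N : rmodType A) (a : A) :
  isomorphic M N -> (forall x : N, x ** a = 0) -> forall x : M, x ** a = 0.
Proof.
move=> [f /bij_inj injf] act0 x; apply: injf.
by rewrite linear_ract act0 linear0.
Qed.

Section StandardModules.
Variables (A : pzRingType) (d : Order.disp_t) (I : finOrderType d) (e : I -> A).
Variable S : I -> rmodType A.
Hypotheses (le : local_idempotents e) (simS : forall i, simple_module (S i))
  (topS : forall i, exists s : S i, s ** e i != 0).
Hypotheses (artA : artinian (rreg A)) (noeA : noetherian (rreg A)).
Implicit Types (i j : I) (m : nat).
Local Notation H := (order_chain e).
Local Notation P i := (pright (e i)).
Let ee := li_idem le.

Lemma pright_eltK i (v : P i) : pright_elt e i (val v) = v.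
Proof. by apply: val_inj; rewrite /= prightP. Qed.

Lemma pright_elt_ract i a b : pright_elt e i (a * b) = pright_elt e i a ** b.
Proof. by apply: val_inj; rewrite /= mulrA. Qed.

Lemma pright_elt_linear i : linear (fun a : rreg A => pright_elt e i a).
Proof.
move=> a b c; apply: val_inj.
by have := mulrDr (e i) ((b : A) * a) (c : A); rewrite mulrA.
Qed.

Section Quo.
Variables (i : I) (K : submod (P i)).

Lemma pright_quo_linear :
  linear (fun a : rreg A => quomodule_pi K (pright_elt e i a)).
Proof.
move=> a b c.
by rewrite (pright_elt_linear i a b c) quomodule_piD quomodule_piZ.
Qed.

Lemma pright_quo_surj : surjective (linear_of pright_quo_linear).
Proof.
move=> q; exists (val (repr (q : Quotient.quot K))) => /=.
by rewrite pright_eltK quomodule_repr.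
Qed.

Lemma pright_quo_composition :
  exists l N, @composition_series _ (quomodule K) l N.
Proof.
apply: exists_composition_series.
  exact: artinian_quo pright_quo_surj artA.
exact: noetherian_quo pright_quo_surj noeA.
Qed.

End Quo.

(** As [f] is idempotent, [x ** f] is unchanged by further multiplications by [f], and each of them
    descends one layer. *)
Lemma filtration_kill (M : rmodType A) (N : nat -> submod M) (f : A) s t (x : M) :
  f * f = f -> (s <= t)%N ->
  (forall k, (s <= k < t)%N -> forall y, y \in N k -> y ** f \in N k.+1) ->
  x \in N s -> x ** f \in N t.
Proof.
move=> ff /subnKC <-; elim: (t - s)%N => [|p IH] kill xN.
  by rewrite addn0; exact: mem_ract.
rewrite addnS -ff -ractA; apply: (kill); first by rewrite leq_addr addnS ltnSn.
apply: IH xN => k /andP[lesk ltk]; apply: kill.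
by rewrite lesk addnS ltnS ltnW.
Qed.

Lemma simple_nonunit_act0 (M : rmodType A) i (x : M) a : simple_module M ->
  x ** e i = x -> in_corner (e i) a -> ~ corner_unit (e i) a -> x ** a = 0.
Proof.
move=> simM xe ae na; have [->|x0] := eqVneq x 0; first exact: ract0l.
apply/(simple_kernel le simM a xe x0) => b.
have -> : e i * a * b * e i = a * (e i * b * e i).
  by rewrite ae.1 !mulrA ae.2.
by move=> /(corner_unitMl le ae (in_cornerE le i b)).
Qed.

Lemma simple_layer_act0 (M : rmodType A) j : simple_module M ->
  ~ isomorphic M (S j) -> forall x : M, x ** e j = 0.
Proof.
move=> simM niso x; apply: contrapT => /eqP xj; apply: niso.
exact: (simple_iso le simS topS simM xj).
Qed.

Lemma iso_act0 (M : rmodType A) i j : isomorphic M (S i) -> i <> j ->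
  forall x : M, x ** e j = 0.
Proof.
move=> isoM ij; apply: isomorphic_act0 isoM _ => x.
exact: (simple_act0 le simS topS).
Qed.

Lemma iso_act_neq0 (M : rmodType A) i : isomorphic M (S i) ->
  exists x : M, x ** e i != 0.
Proof.
move=> [f [g fK gK]]; have [s s0] := topS i; exists (g s).
apply: contra_neq s0 => gs0.
by rewrite -(gK s) -linear_ract gs0 linear0.
Qed.

(** [S j] is a composition factor exactly when [e j] acts nontrivially. The existence of a series is
    assumed because [factors_le] would otherwise hold vacuously. *)
Lemma factors_leP i (M : rmodType A) :
  (exists l N, @composition_series _ M l N) ->
  factors_le S i M <-> forall j (x : M), (i < j)%O -> x ** e j = 0.
Proof.
move=> [l0 [N0 cN0]]; split=> [fM j x ltij|act0 l N [filtN simN] k ltkl].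
  have [[topN botN _] _] := cN0.
  apply: botN; apply: (@filtration_kill _ _ _ 0%N) => // k /andP[_ ltkl].
  have [p lepi isop] := fM _ _ cN0 k ltkl.
  apply/subquo_act0/(iso_act0 isop) => pj.
  by move: lepi; rewrite pj leNgt ltij.
have [j [q qj]] := simple_full le (simN k ltkl).
exists j; last exact: (simple_iso le simS topS (simN k ltkl) qj).
rewrite leNgt; apply/negP => ltij; case/eqP: qj; move: q.
by apply/subquo_act0 => x _; rewrite act0 ?rpred0.
Qed.

Lemma quomodule_pi_ract (M : rmodType A) (K : submod M) (x : M) a :
  quomodule_pi K (x ** a) = quomodule_pi K x ** a.
Proof. exact: quomodule_piZ. Qed.

Fact std_ker0 i : (val (0 : P i) : A) \in H (rank i).+1.
Proof. exact: rpred0. Qed.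

Fact std_kerD i (a : A^c) (u v : P i) : (val u : A) \in H (rank i).+1 ->
  (val v : A) \in H (rank i).+1 -> (val (a *: u + v) : A) \in H (rank i).+1.
Proof.
move=> uH vH; have : (val u : A) * a + val v \in H (rank i).+1.
  by apply: rpredD vH; exact: ideal_mulr.
by [].
Qed.

Definition std_ker i : submod (P i) := submod_of (@std_ker0 i) (@std_kerD i).

Lemma std_kerE i v : v \in std_ker i <-> (val v : A) \in H (rank i).+1.
Proof. exact: submod_ofE. Qed.

Lemma factors_le_std i (K : submod (P i)) :
  factors_le S i (quomodule K) <-> {subset std_ker i <= K}.
Proof.
rewrite (factors_leP i (pright_quo_composition K)).
split=> [act0 v /std_kerE vH|sK j q ltij].
  rewrite -(pright_eltK v); move: vH; move: (val v : A).
  apply: order_chain_ind => [|x y xK yK|a j b ltij].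
  - by have := linear0 (linear_of (pright_elt_linear i)) => /= ->; rewrite rpred0.
  - by have := linearD (linear_of (pright_elt_linear i)) x y => /= ->; rewrite rpredD.
  - rewrite !pright_elt_ract mem_ract //; apply/quomodule_pi_eq0.
    by rewrite quomodule_pi_ract act0 // ltErank.
rewrite -(quomodule_repr q) -quomodule_pi_ract; apply/quomodule_pi_eq0/sK/std_kerE.
by apply/ideal_mull/mem_order_chain => //; rewrite -ltErank.
Qed.

Lemma standard_kernelP i (K : submod (P i)) :
  standard_kernel (P := fun i => P i) S K <-> K = std_ker i.
Proof.
split=> [[/factors_le_std sK minK]|->].
  apply: submod_ext => v; apply/idP/idP; last exact: sK.
  by apply: minK; apply/factors_le_std.
by split=> [|K' /factors_le_std //]; apply/factors_le_std.
Qed.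

Definition std_module i : rmodType A := quomodule (std_ker i).

Definition std_gen i : std_module i := quomodule_pi _ (pright_elt e i 1).

Lemma std_gen_act i a : std_gen i ** a = quomodule_pi _ (pright_elt e i a).
Proof. by rewrite -quomodule_pi_ract -pright_elt_ract mul1r. Qed.

Lemma std_genP i (q : std_module i) : exists a, q = std_gen i ** a.
Proof.
exists (val (repr (q : Quotient.quot (std_ker i)))).
by rewrite std_gen_act pright_eltK quomodule_repr.
Qed.

Lemma std_gen_act0 i a : std_gen i ** a = 0 <-> e i * a \in H (rank i).+1.
Proof. by rewrite std_gen_act quomodule_pi_eq0 std_kerE. Qed.

Lemma std_gen_id i : std_gen i ** e i = std_gen i.
Proof.
rewrite !std_gen_act -[RHS]ract1 std_gen_act; congr quomodule_pi.
by apply: val_inj; rewrite /= ee mulr1.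
Qed.

(** For a local corner this says that [e i A e i] becomes a division ring modulo the ideal of the
    higher idempotents. *)
Definition thin i := e i \notin H (rank i).+1 /\
  forall x, in_corner (e i) x -> ~ corner_unit (e i) x -> x \in H (rank i).+1.

Lemma std_multiplicityP i :
  composition_multiplicity (std_module i) (S i) 1 <-> thin i.
Proof.
have genid := std_gen_id i.
split=> [[l [N [[[topN botN decN] simN] cnt]]]|[nei nonunit]].
  have [k0 k0P] := mem_card1 cnt.
  have other k : (k < l)%N -> k != k0 -> forall x, x \in N k -> x ** e i \in N k.+1.
    move=> ltkl kk0; apply/subquo_act0/simple_layer_act0; first exact: simN.
    move=> isok; have := k0P (Ordinal ltkl); rewrite !inE /=.
    by rewrite -val_eqE /= (negPf kk0) => /asboolPn.
  (* Layer [k0] is the only one isomorphic to [S i], and [e i] kills all others. So the generator,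
     which [e i] fixes, descends to [N k0], and below it [e i] kills all of [N k0.+1]. *)
  have genN : std_gen i \in N k0.
    rewrite -genid; apply: (@filtration_kill _ _ _ 0%N) => //.
    move=> k /andP[_ ltkk0]; apply: other; last by rewrite neq_ltn ltkk0.
    exact: ltn_trans ltkk0 (ltn_ord _).
  have killN x : x \in N k0.+1 -> x ** e i = 0.
    move=> xN; apply: botN; apply: (@filtration_kill _ _ _ k0.+1) xN => //.
    by move=> k /andP[ltk0k ltkl]; apply: other => //; rewrite neq_ltn ltk0k orbT.
  split.
    apply/negP => eH; have [[q /eqP q0] _] := simN _ (ltn_ord k0).
    case: q0.
    have [u ->] := subquo_piP q; apply/subquo_pi_eq0.
    have [a ->] := std_genP (val u).
    have -> : std_gen i = 0 by rewrite -genid; apply/std_gen_act0; rewrite ee.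
    by rewrite ract0l rpred0.
  move=> x xe nx; rewrite -{1}xe.1; apply/std_gen_act0.
  rewrite -{1}xe.2 -ractA; apply: killN.
  have /subquo_pi_eq0 // : subquo_pi (N k0.+1) (SubmoduleElt genN ** x) = 0.
  rewrite subquo_pi_ract; apply: simple_nonunit_act0 xe nx; first exact: simN.
  rewrite -subquo_pi_ract; congr subquo_pi; exact: val_inj.
have gen0 : std_gen i != 0.
  apply: contraNneq nei => g0; rewrite -ee; apply/std_gen_act0.
  by rewrite g0 ract0l.
have [l [N cN]] := pright_quo_composition (std_ker i).
exists l, N; split=> //; have [[topN botN decN] simN] := cN.
(* If [e i] acts nontrivially on layer [k], some [std_gen i ** a] in [N k] has [e i * a * e i] a
   unit, since otherwise [e i] would send it to 0. Then [N k] contains the generator, hence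
   everything, and no simple layer fits above it. *)
have first0 k : (k < l)%N -> isomorphic (layer N k) (S i) -> k = 0%N.
  move=> ltkl /iso_act_neq0[q qi].
  have [u qu] := subquo_piP q.
  have uN : val u ** e i \notin N k.+1.
    apply: contra_neqN qi => uN; rewrite qu -subquo_pi_ract.
    exact/subquo_pi_eq0.
  have [a ua] := std_genP (val u).
  have [[z [_ az _]]|/nonunit na] := EM (corner_unit (e i) (e i * a * e i)).
    have genN : std_gen i \in N k.
      have -> : std_gen i = std_gen i ** (e i * a * e i * z) by rewrite az genid.
      by rewrite -!ractA genid -ua; do 2!apply: mem_ract; exact: valP.
    case: k ltkl genN {q qi u qu uN ua} => // k ltkl genN.
    have [[q /eqP q0] _] := simN k (ltnW ltkl).
    case: q0.
    have [u ->] := subquo_piP q; apply/subquo_pi_eq0.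
    by have [b ->] := std_genP (val u); exact: mem_ract.
  case/negP: uN; rewrite ua ractA.
  suff -> : std_gen i ** (a * e i) = 0 by exact: rpred0.
  by apply/std_gen_act0; rewrite mulrA; apply: na; exact: in_cornerE.
have [k0 ltk0 isok0] : exists2 k, (k < l)%N & isomorphic (layer N k) (S i).
  apply: contrapT => niso; case/eqP: gen0; rewrite -genid.
  apply: botN; apply: (@filtration_kill _ _ _ 0%N) => // k /andP[_ ltkl].
  apply/subquo_act0/simple_layer_act0; first exact: simN.
  by move=> isok; apply: niso; exists k.
apply: (@eq_card1 _ (Ordinal ltk0)) => k; rewrite !inE -val_eqE /=.
have k00 := first0 _ ltk0 isok0; rewrite k00 in isok0 *.
by apply/asboolP/eqP => [|->] //; exact: first0.
Qed.

End StandardModules.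

(** * Layers and traces *)

Section StandardSteps.
Variables (A : pzRingType) (d : Order.disp_t) (I : finOrderType d) (e : I -> A).
Hypothesis le : local_idempotents e.
Implicit Types (i j : I) (m : nat).
Local Notation H := (order_chain e).
Local Notation P i := (pright (e i)).
Let ee := li_idem le.

Section Module.
Variable M : rmodType A.
Implicit Types (X Y : submod M).

(** Expresses that [X / Y] is a standard module by a generator and its annihilator. Being about
    elements, it transports along injective linear maps without any quotient types. *)
Definition std_step j X Y := {subset Y <= X} /\
  exists x, [/\ x \in X, x ** e j = x,
    forall y, y \in X -> exists a, y - x ** a \in Y
  & forall a, x ** a \in Y <-> e j * a \in H (rank j).+1].

Lemma std_stepP j X Y : {subset Y <= X} ->
  isomorphic (subquo X Y) (std_module e j) <-> std_step j X Y.
Proof.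
move=> YX; split=> [/isomorphic_sym[f bijf]|[_ [x [xX xe genx annx]]]].
  split=> //; have [u fu] := subquo_piP (f (std_gen e j)).
  have fE a : f (std_gen e j ** (e j * a)) = subquo_pi Y (u ** e j ** a).
    by rewrite linear_ract fu -subquo_pi_ract ractA.
  exists (val u ** e j); split=> [||y yX|a].
  - exact/mem_ract/valP.
  - by rewrite ractA ee.
  - have [g fK gK] := bijf.
    have [a ga] := std_genP le (g (subquo_pi Y (SubmoduleElt yX))).
    exists a; suff : subquo_pi Y (SubmoduleElt yX - u ** e j ** a) = 0.
      by move/subquo_pi_eq0.
    rewrite subquo_piB -fE.
    by rewrite -ractA (std_gen_id le) -ga gK subrr.
  - have -> : val u ** e j ** a \in Y <-> subquo_pi Y (u ** e j ** a) = 0.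
      by rewrite subquo_pi_eq0.
    rewrite -fE -(linear0 f); split=> [/(bij_inj bijf)/std_gen_act0|h].
      by rewrite mulrA ee.
    by congr (f _); apply/std_gen_act0; rewrite mulrA ee.
pose q := subquo_pi Y (SubmoduleElt xX).
have qE a : q ** a = subquo_pi Y (SubmoduleElt xX ** a) by rewrite subquo_pi_ract.
apply/isomorphic_sym.
apply: (@quomodule_iso _ _ _ (linear_of (@cyclic_map_linear _ _ e _ j q))) => [r|v /=].
  have [u ->] := subquo_piP r; have [a ya] := genx _ (valP u).
  exists (pright_elt e j a); apply/eqP; rewrite -subr_eq0 -oppr_eq0 opprB /=.
  apply/eqP; rewrite qE -subquo_piB.
  by apply/subquo_pi_eq0; move: ya; rewrite -{1}xe ractA.
rewrite std_kerE qE subquo_pi_eq0.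
by have := annx (val v : A); rewrite prightP // => <-.
Qed.

(** This is the product [X H_m], equivalently the trace in [X] of the modules [e j A] with
    [m <= rank j]. *)
Definition trace_sub X m : submod M :=
  gen_sub (fun g => exists x j, [/\ x \in X, (m <= rank j)%N & g = x ** e j]).

Lemma trace_subP X m x j : x \in X -> (m <= rank j)%N -> x ** e j \in trace_sub X m.
Proof. by move=> xX lemj; apply: mem_gen_sub; exists x, j. Qed.

Lemma trace_sub_sub X m : {subset trace_sub X m <= X}.
Proof. by apply: gen_sub_min => _ [x [j [xX _ ->]]]; exact: mem_ract. Qed.

(* X H_m meets Y in Y H_m when X / Y is Delta(j) and j is at least m, because the
   kernel K(j) of e_j A -> Delta(j) satisfies K(j) = K(j) H_m. *)
Lemma std_step_trace_eq j X Y m : std_step j X Y -> (m <= rank j)%N ->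
  forall z, z \in trace_sub X m -> z \in Y -> z \in trace_sub Y m.
Proof.
move=> [_ [x [xX xe genx annx]]] lemj z zX zY.
pose Z y := exists a y', [/\ a \in H m, y' \in trace_sub Y m & y = x ** a + y'].
have Z0 : Z 0 by exists 0, 0; rewrite ract0 addr0 !rpred0.
have ZD (c : A^c) u v : Z u -> Z v -> Z (c *: u + v).
  move=> [a [u' [aH u'Y ->]]] [b [v' [bH v'Y ->]]].
  exists (a * c + b), (u' ** c + v').
  rewrite rpredD ?(rpredD, mem_ract, ideal_mulr) //; split=> //.
  by rewrite scale_ract ractDl ractDr ractA addrACA.
have [a [z' [aH z'Y zE]]] : Z z.
  apply/(submod_ofE Z0 ZD); apply: gen_sub_min zX => _ [y [p [yX lemp ->]]].
  apply/submod_ofE; have [b yb] := genx y yX.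
  exists (b * e p), ((y - x ** b) ** e p); rewrite trace_subP //; split=> //.
    by apply/ideal_mull/mem_order_chain.
  by rewrite ractBl ractA addrC subrK.
have xaY : x ** a \in Y by rewrite -[x ** a](addrK z') -zE rpredB ?(trace_sub_sub z'Y).
rewrite zE rpredD // -xe ractA.
suff gen h : h \in H (rank j).+1 -> x ** (e j * h) \in trace_sub Y m.
  by rewrite -ee -mulrA; apply: gen; apply/annx.
move: h; apply: order_chain_ind => [|h h' hY h'Y|c p b ltjp].
- by rewrite mulr0 ract0 rpred0.
- by rewrite mulrDr ractDr rpredD.
- rewrite !mulrA -(ee p) mulrA -ractA mem_ract // -ractA.
  apply: trace_subP; last by rewrite (leq_trans lemj) // ltnW.
  by apply/annx; do 2!rewrite ?mulrA; apply/ideal_mull/mem_order_chain.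
Qed.

Lemma std_step_trace0 j X Y m : std_step j X Y -> (rank j < m)%N ->
  {subset trace_sub X m <= Y}.
Proof.
move=> [_ [x [xX xe genx annx]]] ltjm.
apply: gen_sub_min => _ [y [p [yX lemp ->]]].
have [b yb] := genx y yX; rewrite -[y](subrK (x ** b)) ractDl.
apply: rpredD; first exact: mem_ract.
rewrite ractA; apply/annx; rewrite mulrA; apply/ideal_mull/mem_order_chain => //.
exact: leq_trans lemp.
Qed.

(** Since [N 0 = N 0 H_m], applying [std_step_trace_eq] layer by layer puts [N k] into [N k H_m].
    The layer below [N k] is a standard module with [rank j < m], killed by [H_m], so it
    vanishes. *)
Lemma std_steps_trace_full (N : nat -> submod M) m k :
  (forall x, x \in trace_sub (N 0%N) m) ->
  (forall t, (t < k)%N -> exists2 j, (m <= rank j)%N & std_step j (N t) (N t.+1)) ->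
  forall j, (rank j < m)%N -> std_step j (N k) (N k.+1) ->
  e j \in H (rank j).+1.
Proof.
move=> full up j ltjm stepk.
have sub s : (s <= k)%N -> {subset N k <= N (k - s)%N}.
  elim: s => [_ z|s IH ltsk z zk]; first by rewrite subn0.
  have [|p _ [sub _]] := up (k - s.+1)%N.
    by rewrite ltn_subrL (leq_trans _ ltsk).
  by apply: sub; rewrite subnSK //; apply: IH zk; exact: ltnW.
have low s : (s <= k)%N -> forall z, z \in trace_sub (N (k - s)%N) m ->
    z \in N k -> z \in N k.+1.
  elim: s => [_ z|s IH ltsk z zN zk].
    by rewrite subn0 => zN _; exact: std_step_trace0 stepk ltjm _ zN.
  have [|p lemp stepp] := up (k - s.+1)%N.
    by rewrite ltn_subrL (leq_trans _ ltsk).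
  apply: (IH (ltnW ltsk)) (zk); rewrite -subnSK //.
  apply: std_step_trace_eq stepp lemp _ zN _.
  by rewrite subnSK //; apply: sub zk; exact: ltnW.
have [_ [x [xN _ _ annx]]] := stepk; rewrite -[e j]mulr1; apply/annx.
by rewrite ract1; apply: (low k) => //; rewrite subnn.
Qed.

End Module.
End StandardSteps.

(** * Projectivity of the ideals of the chain *)

Section RightDual.
Variable A : pzRingType.

Definition right_linear_on (X : {pred A}) (phi : A -> A) :=
  forall a x y, x \in X -> y \in X -> phi (x * a + y) = phi x * a + phi y.

Definition has_right_dual_basis (X : {pred A}) : Prop :=
  exists (T : finType) (g : T -> A) (phi : T -> A -> A),
    [/\ forall t, g t \in X, forall t, right_linear_on X (phi t)
      & forall x, x \in X -> x = \sum_t g t * phi t x].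

Lemma has_right_dual_basisE (X : {pred A}) :
  has_right_dual_basis X <-> @has_dual_basis A^c X.
Proof. by split=> -[T [g [phi [gX phiX phiK]]]]; exists T, g, phi; split. Qed.

Section RightLinear.
Variables (X : submod (rreg A)) (phi : A -> A).
Hypothesis phiX : right_linear_on X phi.

Let X0 : (0 : A) \in X := rpred0 X.

Lemma right_linear_on0 : phi 0 = 0.
Proof.
have := phiX (-1) X0 X0.
by rewrite mul0r addr0 mulrN1 addNr => ->.
Qed.

Lemma right_linear_onD (x y : A) : x \in X -> y \in X -> phi (x + y) = phi x + phi y.
Proof. by move=> xX yX; have := phiX 1 xX yX; rewrite !mulr1. Qed.

Lemma right_linear_onM (x a : A) : x \in X -> phi (x * a) = phi x * a.
Proof.
move=> xX; have := phiX a xX X0.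
by rewrite right_linear_on0 !addr0.
Qed.

Lemma right_linear_on_sum (T : finType) (F : T -> A) :
  (forall t, F t \in X) -> phi (\sum_t F t) = \sum_t phi (F t).
Proof.
move=> FX; suff [] : phi (\sum_t F t) = \sum_t phi (F t) /\ (\sum_t F t : A) \in X by [].
apply: (big_ind2 (fun x y => phi x = y /\ x \in X)) => [|x a y b [xa xX] [yb yX]|t _].
- by split; [exact: right_linear_on0 | exact: (rpred0 X)].
- split; first by rewrite right_linear_onD ?xa ?yb.
  exact: (rpredD (S := X) xX yX).
- by split.
Qed.

End RightLinear.

Lemma has_right_dual_basis1 (f : A) (X : {pred A}) :
  (forall x, x \in X <-> f * x = x) -> f * f = f -> has_right_dual_basis X.
Proof.
move=> XE ff; exists unit, (fun=> f), (fun _ x => x); split=> // [t|x /XE fx].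
  exact/XE.
by rewrite (big_pred1 tt) ?fx // => -[].
Qed.

(** Any finite generating family carries a dual basis: the old basis elements are expanded in the
    [g t] and the functionals recombined. This allows generators of a chosen shape. *)
Lemma right_dual_basis_gen (X : submod (rreg A)) (T : finType) (g : T -> A) :
  has_right_dual_basis X ->
  (forall x : A, x \in X -> exists c : T -> A, x = \sum_t g t * c t) ->
  exists phi : T -> A -> A, (forall t, right_linear_on X (phi t)) /\
    forall x : A, x \in X -> x = \sum_t g t * phi t x.
Proof.
move=> [U [g0 [chi [g0X chiX chiK]]]] gen.
have /choice[c cP] u : exists c : T -> A, g0 u = \sum_t g t * c t by exact: gen.
exists (fun t x => \sum_u c u t * chi u x); split=> [t a x y xX yX|x xX].
  rewrite mulr_suml -big_split; apply: eq_bigr => u _ /=.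
  by rewrite chiX // mulrDr mulrA.
rewrite {1}[x]chiK //; under eq_bigr => u _ do rewrite cP mulr_suml.
rewrite exchange_big; apply: eq_bigr => t _ /=.
by rewrite mulr_sumr; apply: eq_bigr => u _; rewrite mulrA.
Qed.

End RightDual.

Arguments right_linear_on : clear implicits.
Arguments has_right_dual_basis : clear implicits.

Section HeredityIdeals.
Variables (A : pzRingType) (d : Order.disp_t) (I : finOrderType d) (e : I -> A).
Hypothesis le : local_idempotents e.
Implicit Types (i j : I) (m : nat).
Local Notation H := (order_chain e).
Local Notation P i := (pright (e i)).
Let ee := li_idem le.

Section Compress.
Variable f : A.

Fact compress0 m : f * 0 = 0 /\ 0 \in H m.
Proof. by rewrite mulr0 rpred0. Qed.

Fact compressD m (a : A^c) (x y : rreg A) : f * (x : A) = x /\ (x : A) \in H m ->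
  f * (y : A) = y /\ (y : A) \in H m ->
  f * (a *: x + y : A) = a *: x + y /\ (a *: x + y : A) \in H m.
Proof.
move=> [fx xH] [fy yH].
have : f * ((x : A) * a + y) = (x : A) * a + y /\ (x : A) * a + y \in H m.
  by rewrite mulrDr mulrA fx fy; split=> //; rewrite rpredD ?ideal_mulr.
by [].
Qed.

(* the right ideal f H_m *)
Definition compress m : submod (rreg A) := submod_of (compress0 m) (@compressD m).

Lemma compressE m (x : A) : x \in compress m <-> f * x = x /\ x \in H m.
Proof. exact: (submod_ofE (compress0 m) (@compressD m) x). Qed.

Lemma compress_sub m m' : (m <= m')%N -> {subset compress m' <= compress m}.
Proof.
move=> lemm' x /compressE[fx xH]; apply/compressE; split=> //.
exact: (order_chain_sub le lemm').
Qed.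

Hypothesis ff : f * f = f.

Lemma mem_compress m x : x \in H m -> f * x \in compress m.
Proof. by move=> xH; apply/compressE; rewrite mulrA ff; split=> //; exact: ideal_mull. Qed.

Lemma compress_ind m (Q : A -> Prop) : Q 0 ->
  (forall x y : A, x \in compress m -> y \in compress m -> Q x -> Q y -> Q (x + y)) ->
  (forall a j b, (m <= rank j)%N -> Q (f * a * e j * b)) ->
  forall x : A, x \in compress m -> Q x.
Proof.
move=> Q0 QD Qe x /compressE[fx xH]; rewrite -fx.
suff [] : Q (f * x) /\ f * x \in compress m by [].
pose Q' (x : A) := Q (f * x) /\ f * x \in compress m.
apply: (@order_chain_ind _ _ _ e m Q') xH => [|x' y [Qx xX] [Qy yX]|a j b lemj].
- by rewrite /Q' mulr0; split=> //; exact: (rpred0 (compress m)).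
- by rewrite /Q' mulrDr; split; [exact: QD | exact: (@rpredD _ (compress m) _ _ xX yX)].
- split; first by rewrite !mulrA; exact: Qe.
  by apply: mem_compress; apply/ideal_mulr/ideal_mull/mem_order_chain.
Qed.

Lemma mem_compress_e m a j : (m <= rank j)%N -> f * a * e j \in compress m.
Proof.
move=> lemj; rewrite -mulrA; apply: mem_compress.
by apply/ideal_mull/mem_order_chain.
Qed.

(** [f * a * e j * b] is [(f * a * e j) * (e j * b)] with first factor in the domain of [phi], so
    its image still ends in [e j * b]. *)
Lemma right_linear_compress p m phi : (p <= m)%N ->
  right_linear_on A (compress p) phi -> forall x : A, x \in compress m -> phi x \in H m.
Proof.
move=> lepm phiX; apply: compress_ind => [|x y xX yX xH yH|a j b lemj].
- by rewrite (right_linear_on0 phiX) rpred0.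
- by rewrite (right_linear_onD phiX) ?rpredD //; exact: compress_sub lepm _ _.
- rewrite -ee mulrA -mulrA (right_linear_onM phiX); last first.
    by apply: mem_compress_e; exact: leq_trans lemj.
  by rewrite mulrA ideal_mulr // ideal_mull // mem_order_chain.
Qed.

Lemma compress_finite_gen p : noetherian (rreg A) ->
  exists (T : finType) (g : T -> A) (l : T -> I),
    (forall t, [/\ (p <= rank (l t))%N, g t * e (l t) = g t & g t \in compress p]) /\
    forall x : A, x \in compress p -> exists c : T -> A, x = \sum_t g t * c t.
Proof.
move=> noeA.
pose G (x : rreg A) := exists l, [/\ (p <= rank l)%N, (x : A) * e l = x
  & (x : A) \in compress p].
have [T [g [/choice[l lP] gen]]] := noetherian_finite_gen G noeA.
exists T, g, l; split=> // x xX.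
suff : (x : rreg A) \in span_of g by move=> /submod_ofE.
move: x xX; apply: compress_ind => [|x y _ _ xg yg|a j b lepj].
- exact: (rpred0 (span_of g)).
- exact: (rpredD (S := span_of g) xg yg).
- apply: (mem_ract (X := span_of g) b); apply: gen; exists j; split=> //.
    by rewrite -mulrA ee.
  exact: mem_compress_e.
Qed.

(** A dual basis makes [f H_p] a direct summand of a finite sum of modules [e l A]. Multiplication
    by [H_m] makes [f H_m] a summand of the matching sum of the [e l H_m], and the two levels of
    dual bases compose. *)
Lemma compress_glue p m : noetherian (rreg A) -> (p <= m)%N ->
  has_right_dual_basis A (compress p) ->
  (forall l, (p <= rank l)%N -> exists X : submod (rreg A),
    has_right_dual_basis A X /\
    forall x : A, x \in X <-> e l * x = x /\ x \in H m) ->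
  has_right_dual_basis A (compress m).
Proof.
move=> noeA lepm dualp duall.
have [T [g [l [gP gen]]]] := compress_finite_gen p noeA.
have [phi [phiX phiK]] := right_dual_basis_gen dualp gen.
(* The factor [e (l t)] forces values into [e (l t) A]; it does not disturb the expansion because
   [g t * e (l t) = g t]. *)
pose psi t x := e (l t) * phi t x.
have psiX t : right_linear_on A (compress p) (psi t).
  by move=> a x y xX yX; rewrite /psi phiX // mulrDr mulrA.
have psiK (x : A) : x \in compress p -> x = \sum_t g t * psi t x.
  move=> xX; rewrite {1}[x]phiK //; apply: eq_bigr => t _.
  by have [_ ge _] := gP t; rewrite mulrA ge.
have duall' t : exists X : submod (rreg A), has_right_dual_basis A X /\
    forall x : A, x \in X <-> e (l t) * x = x /\ x \in H m.
  by have [lept _ _] := gP t; exact: duall.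
have [X XP] := choice duall'.
(* The index type of the dual basis varies with [t], so the witnesses are extracted one after
   another as dependent functions. *)
pose U t := projT1 (cid (XP t).1).
have UP t : exists (y : U t -> A) (chi : U t -> A -> A),
    [/\ forall u, y u \in X t, forall u, right_linear_on A (X t) (chi u)
      & forall x : A, x \in X t -> x = \sum_u y u * chi u x].
  exact: projT2 (cid (XP t).1).
pose y t := projT1 (cid (UP t)).
have yP t : exists chi : U t -> A -> A,
    [/\ forall u, y t u \in X t, forall u, right_linear_on A (X t) (chi u)
      & forall x : A, x \in X t -> x = \sum_u y t u * chi u x].
  exact: projT2 (cid (UP t)).
pose chi t := projT1 (cid (yP t)).
have chiP t : [/\ forall u, y t u \in X t, forall u, right_linear_on A (X t) (chi t u)
      & forall x : A, x \in X t -> x = \sum_u y t u * chi t u x].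
  exact: projT2 (cid (yP t)).
have psiXt t (x : A) : x \in compress m -> psi t x \in X t.
  move=> xX; apply/(XP t).2; split; first by rewrite /psi mulrA ee.
  exact: right_linear_compress lepm (psiX t) _ xX.
exists {t : T & U t}, (fun p => g (tag p) * y (tag p) (tagged p)),
  (fun p x => chi (tag p) (tagged p) (psi (tag p) x)).
split=> [[t u]|[t u] a x z xX zX|x xX] /=.
- have [yX _ _] := chiP t; have /(XP t).2[_ yH] := yX u.
  have [_ _ /compressE[fg _]] := gP t.
  by apply/compressE; rewrite mulrA fg; split=> //; exact: ideal_mull.
- have [_ chiX _] := chiP t; rewrite psiX; try exact: compress_sub lepm _ _.
  by rewrite chiX //; exact: psiXt.
- rewrite {1}[x]psiK; last exact: compress_sub lepm _ _.
  rewrite -(sig_big_dep (fun=> true) (fun _ _ => true)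
    (fun t u => g t * y t u * chi t u (psi t x))) /=.
  apply: eq_bigr => t _; have [_ _ chiK] := chiP t.
  rewrite {1}[psi t x]chiK ?psiXt // mulr_sumr.
  by apply: eq_bigr => u _; rewrite mulrA.
Qed.

End Compress.

Lemma compress_dual_left f m : f * f = f ->
  has_right_dual_basis A (H m) -> has_right_dual_basis A (compress f m).
Proof.
move=> ff [T [g [phi [gH phiH phiK]]]]; exists T, (fun t => f * g t), phi.
split=> [t|t a x y /compressE[_ xH] /compressE[_ yH]|x /compressE[fx xH]].
- exact: mem_compress.
- exact: phiH.
- rewrite -{1}fx {1}[x]phiK // mulr_sumr.
  by apply: eq_bigr => t _; rewrite mulrA.
Qed.

Lemma compress_dual_all : noetherian (rreg A) ->
  (forall i, has_right_dual_basis A (compress (e i) (rank i).+1)) ->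
  forall m, has_right_dual_basis A (H m).
Proof.
move=> noeA duali.
have dual i m : has_right_dual_basis A (compress (e i) m).
  have [p] := ubnP (#|I| - rank i); elim: p i m => // p IH i m ltp.
  have [lemi|ltim] := leqP m (rank i).
    apply: (@has_right_dual_basis1 _ (e i)) => // x; split=> [/compressE[] //|fx].
    apply/compressE; split=> //; rewrite -fx.
    by apply/ideal_mulr/mem_order_chain.
  apply: (compress_glue (ee i) noeA ltim (duali i)) => l ltil.
  exists (compress (e l) m); split=> [|x]; last exact: compressE.
  apply: IH; move: ltp; rewrite ltnS; apply: leq_trans.
  by rewrite ltn_sub2l // rank_lt.
(* For [f = 1], [compress 1 0] is [A] and [compress 1 m] is [H m]. *)
move=> m; have : has_right_dual_basis A (compress 1 m).
  apply: (compress_glue (mulr1 1) noeA (leq0n m)) => [|l _].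
    apply: (@has_right_dual_basis1 _ 1); last exact: mulr1.
    move=> x; rewrite compressE; split=> [[] //|->]; split=> //.
    exact: order_chain_bot.
  by exists (compress (e l) m); split=> // x; exact: compressE.
have E x : x \in compress 1 m <-> x \in H m.
  by rewrite compressE mul1r; split=> [[]|].
move=> [T [g [phi [gX phiX phiK]]]]; exists T, g, phi; split=> [t|t a x y xH yH|x xH].
- exact/E.
- by apply: phiX; apply/E.
- by apply: phiK; apply/E.
Qed.

End HeredityIdeals.

(** * Standard filtrations of the kernels *)

Section StandardFiltration.
Variables (A : pzRingType) (d : Order.disp_t) (I : finOrderType d) (e : I -> A).
Hypotheses (le : local_idempotents e) (noeA : noetherian (rreg A)).
Implicit Types (i j : I) (m : nat).
Local Notation H := (order_chain e).
Local Notation P i := (pright (e i)).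
Let ee := li_idem le.

Section Layer.
Variables (f : A) (j : I).
Hypotheses (ff : f * f = f) (thinj : thin e j).
Local Notation m := (rank j).
Local Notation X := (compress e f m).
Local Notation Y := (compress e f m.+1).
Hypothesis dualX : has_right_dual_basis A X.

Let YX : {subset Y <= X}.
Proof. exact: compress_sub. Qed.

Let gen_mod r (g : 'I_r -> A) :=
  (forall t, g t \in X /\ g t * e j = g t) /\
  forall x : A, x \in X -> exists c : 'I_r -> A, x - \sum_t g t * c t \in Y.

Let exists_gen_mod : exists r (g : 'I_r -> A), gen_mod g.
Proof.
have [T [g [l [gP gen]]]] := compress_finite_gen le ff m noeA.
(* Generators ending in [e l] with [l] above [j] already lie in [Y]. *)
pose g' t := if l t == j then g t else 0.
exists #|T|, (fun t => g' (enum_val t)); split=> [t|x xX].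
  rewrite /g'; case: eqP => [ltj|_].
    by have [_ ge gX] := gP (enum_val t); split=> //; rewrite -ltj.
  by rewrite mul0r; split=> //; exact: (rpred0 X).
have [c ->] := gen x xX; exists (fun t => c (enum_val t)).
rewrite -(big_enum_val (A := T) (fun t => g' t * c t)) /=.
rewrite (eq_bigl predT) // -sumrB.
apply: (@submod_sum_mem _ (rreg A) Y) => t _; rewrite /g'.
have [leml ge gX] := gP t; case: eqP => [_|nlj]; first by rewrite subrr (rpred0 Y).
rewrite mul0r subr0; apply: (mem_ract (X := Y) (c t)).
have [/nlj //|ltml] := eq_or_rank_lt (i := j) (j := l t) leml.
apply/compressE; have /compressE[fg _] := gX; split=> //.
by rewrite -ge; apply/ideal_mull/mem_order_chain.
Qed.

(* A minimal generating family of f H_m modulo f H_(m+1) is independent there,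
   since e_j A e_j is a division ring modulo H_(m+1); the functionals given by
   projectivity then detect each coefficient. *)
Lemma compress_basis : exists r (g : 'I_r -> A),
  [/\ forall t, g t \in X /\ g t * e j = g t,
      forall x : A, x \in X -> exists c : 'I_r -> A, x - \sum_t g t * c t \in Y
    & forall a : 'I_r -> A, \sum_t g t * a t \in Y ->
        forall t, e j * a t \in H m.+1].
Proof.
have ex : exists r, `[< exists g : 'I_r -> A, gen_mod g >].
  by have [r gr] := exists_gen_mod; exists r; apply/asboolP.
case: (ex_minnP ex) => r /asboolP[g [gX gen]] minr; exists r, g; split=> //.
have [_ nonunit] := thinj.
(* If some [c s] were a unit, [g s] could be expressed by the other generators modulo [Y], against
   the minimality of [r]. So every [c t] is a non-unit, hence in [H (rank j).+1] by thinness. *)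
have indep (c : 'I_r -> A) : (forall t, in_corner (e j) (c t)) ->
    \sum_t g t * c t \in Y -> forall t, c t \in H m.+1.
  move=> cj sY s; apply: nonunit => // -[z [_ cz _]].
  case: r g gX gen minr c cj sY s cz => [? ? ? ? ? ? ? []//|r] g gX gen minr c cj sY s cz.
  suff : (r.+1 <= r)%N by rewrite ltnn.
  apply: minr; apply/asboolP; exists (fun t => g (lift s t)); split=> // x xX.
  have [b xb] := gen x xX.
  (* With [c s * z = e j], the relation says that [g s] is minus the sum of the other
     [g t * c t * z] modulo [Y]; this is substituted for [g s]. *)
  exists (fun t => b (lift s t) - c (lift s t) * z * b s).
  set w := _ - _; suff -> : w = x - \sum_t g t * b t + (\sum_t g t * c t) * (z * b s).
    exact: (@rpredD _ Y _ _ xb (mem_ract (X := Y) (z * b s) sY)).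
  rewrite {}/w !(bigD1_ord s) //= mulrDl -[g s * c s * _]mulrA.
  rewrite [c s * _]mulrA cz mulrA (gX s).2 mulr_suml.
  under eq_bigr => t _ do rewrite mulrBr -mulrA mulrA.
  rewrite sumrB opprB addrA addrAC [g s * _ + _ in RHS]addrC opprD !addrA.
  by rewrite subrK.
have [U [g0 [chi [g0X chiX chiK]]]] := dualX.
have /choice[c cP] u : exists c : 'I_r -> A, g0 u - \sum_t g t * c t \in Y.
  exact: gen.
pose phi t x := e j * \sum_u c u t * chi u x.
have phiX t : right_linear_on A X (phi t).
  move=> a x y xX yX; rewrite /phi -mulrA mulr_suml -mulrDr; congr (_ * _).
  rewrite -big_split; apply: eq_bigr => u _ /=.
  by rewrite chiX // mulrDr mulrA.
have phiK (x : A) : x \in X -> x - \sum_t g t * phi t x \in Y.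
  move=> xX.
  have -> : x - \sum_t g t * phi t x
      = \sum_u (g0 u - \sum_t g t * c u t) * chi u x.
    under [RHS]eq_bigr => u _ do rewrite mulrBl mulr_suml.
    rewrite sumrB -chiK // exchange_big; congr (_ - _); apply: eq_bigr => t _ /=.
    rewrite mulrA (gX t).2 mulr_sumr.
    by apply: eq_bigr => u _; rewrite mulrA.
  apply: (@submod_sum_mem _ (rreg A) Y) => u _.
  exact: (mem_ract (X := Y) _ (cP u)).
(* [g s] and [\sum_t g t * phi t (g s)] agree modulo [Y]. The leading [e j] in [phi] and
   [g s * e j = g s] keep the coefficients in the corner, where [indep] applies. *)
have phig t s : (if s == t then e j else 0) - phi t (g s) \in H m.+1.
  apply: (indep (fun t => (if s == t then e j else 0) - phi t (g s))) => [{}t|].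
    apply: in_cornerB; first by case: eqP => _; [exact: in_corner_id | exact: in_corner0].
    split; first by rewrite /phi mulrA ee.
    by rewrite -(right_linear_onM (phiX t)) ?(gX s).2 ?(gX s).1.
  under eq_bigr => t' _ do rewrite mulrBr.
  rewrite sumrB (bigD1 s) //= eqxx (gX s).2 big1 ?addr0; last first.
    by move=> t' /negPf; rewrite eq_sym => ->; rewrite mulr0.
  exact/phiK/(gX s).1.
(* By [phig], [phi t] takes on [\sum_s g s * a s] a value congruent to [e j * a t], and it maps [Y]
   into [H (rank j).+1]. *)
move=> a aY t.
have gaX s : g s * a s \in X by exact: (mem_ract (X := X) _ (gX s).1).
rewrite -[e j * a t](subrK (phi t (\sum_s g s * a s))) rpredD //; last first.
  exact: (right_linear_compress le ff (leqnSn m) (phiX t)).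
rewrite (right_linear_on_sum (phiX t)) //.
have -> : e j * a t = \sum_s (if s == t then e j else 0) * a s.
  rewrite (bigD1 t) //= eqxx big1 ?addr0 // => s /negPf ->.
  by rewrite mul0r.
rewrite -sumrB rpred_sum // => s _.
rewrite (right_linear_onM (phiX t)) ?(gX s).1 // -mulrBl.
exact: ideal_mulr.
Qed.

(** The intermediate submodules are [Y] plus the span of the [g t] with [s <= t], running from [X]
    at [s = 0] to [Y] at [s = r]. Independence modulo [Y] gives each generator the annihilator
    required by [std_step]. *)
Lemma compress_layer_steps :
  steps (fun U V : submod (rreg A) => exists p, std_step e p U V) X Y.
Proof.
have [r [g [gX gen inj]]] := compress_basis.
pose Zp s (x : rreg A) := x \in X /\ exists c : 'I_r -> A,
  (forall t : 'I_r, (t < s)%N -> c t = 0) /\ (x : A) - \sum_t g t * c t \in Y.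
have Z0 s : Zp s 0.
  split; first exact: rpred0.
  exists (fun=> 0); split=> //; rewrite big1 ?subr0 ?(rpred0 Y) // => t _.
  by rewrite mulr0.
have ZD s (a : A^c) (x y : rreg A) : Zp s x -> Zp s y -> Zp s (a *: x + y).
  move=> [xX [c [c0 xc]]] [yX [b [b0 yb]]]; split; first by rewrite rpredD ?rpredZ.
  exists (fun t => c t * a + b t); split=> [t lts|].
    by rewrite c0 ?b0 // mul0r addr0.
  have := @rpredD _ Y _ _ (mem_ract (X := Y) a xc) yb.
  set u := (X in X \in _); set v := (X in _ -> X \in _); suff -> : u = v by [].
  rewrite /u /v -[LHS]/(((x : A) - \sum_t g t * c t) * a
    + ((y : A) - \sum_t g t * b t)) -[a *: x + y]/((x : A) * a + y).
  rewrite mulrBl addrACA -opprD mulr_suml -big_split; congr (_ - _).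
  by apply: eq_bigr => t _ /=; rewrite mulrDr mulrA.
pose Z s := submod_of (Z0 s) (@ZD s).
have ZE s (x : A) : x \in Z s <-> Zp s x by exact: (submod_ofE (Z0 s) (@ZD s) x).
exists r, Z; split.
- apply: submod_ext => x; apply/idP/idP => [/ZE[] //|xX].
  by apply/ZE; split=> //; have [c xc] := gen x xX; exists c.
- apply: submod_ext => x; apply/idP/idP => [/ZE[_ [c [c0]]]|xY].
    rewrite big1 ?subr0 // => t _; by rewrite c0 ?mulr0 // ltn_ord.
  apply/ZE; split; first exact: YX.
  by exists (fun=> 0); split=> //; rewrite big1 ?subr0 // => t _; rewrite mulr0.
move=> k ltkr; exists j; pose s := Ordinal ltkr; split.
  move=> x /ZE[xX [c [c0 xc]]]; apply/ZE; split=> //; exists c; split=> // t ltk.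
  by apply: c0; exact: ltnW.
exists (g s); split=> [||y /ZE[yX [c [c0 yc]]]|a].
- apply/ZE; split; first exact: (gX s).1.
  exists (fun t => if t == s then e j else 0); split=> [t|].
    by case: eqP => // -> /=; rewrite ltnn.
  rewrite (bigD1 s) //= eqxx (gX s).2 big1 ?addr0 ?subrr ?(rpred0 Y) // => t /negPf ->.
  by rewrite mulr0.
- exact: (gX s).2.
- exists (c s); apply/ZE; split.
    exact: (@rpredB _ X _ _ yX (mem_ract (X := X) (c s) (gX s).1)).
  exists (fun t => if t == s then 0 else c t); split=> [t|].
    rewrite ltnS leq_eqVlt => /orP[/eqP tk|ltk].
      by have -> : t = s; [exact: val_inj | rewrite eqxx].
    by case: eqP => // _; exact: c0.
  move: yc; rewrite (bigD1 s) //= [X in _ -> _ - X \in _](bigD1 s) //= eqxx.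
  rewrite mulr0 add0r opprD addrA.
  by under [X in _ -> _ - X \in _]eq_bigr => t /negPf -> do [].
- split=> [/ZE[_ [c [c0 ac]]]|aH].
    pose b t := (if t == s then a else 0) - c t.
    have : \sum_t g t * b t \in Y.
      under eq_bigr => t _ do rewrite mulrBr.
      rewrite sumrB (bigD1 s) //= eqxx big1 ?addr0 // => t /negPf ->.
      by rewrite mulr0.
    by move=> /inj/(_ s); rewrite /b eqxx c0 ?subr0.
  apply/ZE; have gaY : g s * a \in Y.
    apply/compressE; have /compressE[fg _] := (gX s).1; rewrite mulrA fg; split=> //.
    by rewrite -(gX s).2 -mulrA; exact: ideal_mull.
  split; first exact: YX.
  by exists (fun=> 0); split=> //; rewrite big1 ?subr0 // => t _; rewrite mulr0.
Qed.

End Layer.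

Lemma compress_steps f m : f * f = f -> (forall j, thin e j) ->
  (forall p, has_right_dual_basis A (compress e f p)) -> (m <= #|I|)%N ->
  steps (fun U V : submod (rreg A) => exists p, std_step e p U V)
    (compress e f m) (compress e f #|I|).
Proof.
move=> ff thine dual; move mn : (#|I| - m)%N => n; elim: n m mn => [|n IH] m mn lem.
  have -> : m = #|I| by apply/eqP; rewrite eqn_leq lem -subn_eq0 mn.
  exact: steps_refl.
have ltm : (m < #|I|)%N by rewrite -subn_gt0 mn.
have rm := rank_enum_val (Ordinal ltm).
apply: (@steps_trans _ _ _ (compress e f m.+1)); last by apply: IH; rewrite ?subnS ?mn.
rewrite -[m]/(nat_of_ord (Ordinal ltm)) -rm.
exact: compress_layer_steps.
Qed.

Lemma std_step_preim (M : rmodType A) (h : {linear M -> rreg A}) j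
  (X Y : submod (rreg A)) : injective h ->
  (forall x, x \in X -> exists y, h y = x) ->
  std_step e j X Y -> std_step e j (preim_sub h X) (preim_sub h Y).
Proof.
move=> injh imh [YX [x [xX xe genx annx]]]; split; first exact: preim_sub_mono.
have [y yx] := imh x xX; exists y; split=> [||z /submod_ofE zX|a].
- by apply/submod_ofE; rewrite yx.
- by apply: injh; rewrite linear_ract yx.
- have [a za] := genx _ zX; exists a; apply/submod_ofE.
  by rewrite linearB linear_ract yx.
- by rewrite -annx -yx -linear_ract; exact: submod_ofE.
Qed.

Section Kernel.
Variable i : I.
Local Notation K := (submodule (std_ker e i)).

(** Elements of the kernel are nested subtypes over [A]; this map identifies the kernel with a right
    ideal. *)
Definition std_ker_val (x : K) : rreg A := val (val x).

Lemma std_ker_val_linear : linear std_ker_val.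
Proof.
move=> a x y.
by rewrite /std_ker_val (linearP (val : K -> P i)) (linearP (val : P i -> rreg A)).
Qed.

Let h := linear_of std_ker_val_linear.

Lemma std_ker_val_inj : injective h.
Proof. by move=> x y /val_inj/val_inj. Qed.

Lemma std_ker_valP (x : A) :
  x \in compress e (e i) (rank i).+1 <-> exists y : K, h y = x.
Proof.
split=> [/compressE[ex xH]|[y <-]].
  have xK : pright_elt e i x \in std_ker e i by apply/std_kerE; rewrite /= ex.
  by exists (SubmoduleElt xK).
apply/compressE; split; first exact: prightP.
by apply/std_kerE; exact: valP.
Qed.

Lemma std_ker_projective :
  projective K <-> has_right_dual_basis A (compress e (e i) (rank i).+1).
Proof.
rewrite has_right_dual_basisE; apply: projective_dual_basis std_ker_val_inj _ _.
  exact: std_ker_valP.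
exact: noetherian_fg_sub.
Qed.

Lemma std_ker_filtered : (forall j, thin e j) ->
  (forall p, has_right_dual_basis A (compress e (e i) p)) ->
  delta_filtered (std_module e) K.
Proof.
move=> thine dual.
have [l [N [N0 Nl stepN]]] := compress_steps (ee i) thine dual (rank_lt i).
have Nsub k : (k <= l)%N -> {subset N k <= N 0%N}.
  elim: k => [_ x //|k IH ltkl x xN]; apply: (IH (ltnW ltkl)).
  by have [p [sub _]] := stepN k ltkl; exact: sub.
have step k : (k < l)%N ->
    exists j, std_step e j (preim_sub h (N k)) (preim_sub h (N k.+1)).
  move=> ltkl; have [p stepp] := stepN k ltkl; exists p.
  apply: std_step_preim stepp; first exact: std_ker_val_inj.
  by move=> x /(Nsub k (ltnW ltkl)); rewrite N0 => /std_ker_valP.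
exists l, (fun k => preim_sub h (N k)); split.
  split=> [x|x /submod_ofE|k /step[p []] //].
    by apply/submod_ofE; rewrite N0; apply/std_ker_valP; exists x.
  rewrite Nl => /compressE[_ /(order_chain_top (leqnn _)) x0].
  by apply: std_ker_val_inj; rewrite linear0.
move=> k /step[p stepp]; exists p; apply/(std_stepP le) => //.
by case: stepp.
Qed.

Lemma std_ker_trace (N : submod K) m : (m <= (rank i).+1)%N ->
  (forall x, x \in N) -> forall x, x \in trace_sub e N m.
Proof.
move=> lem top x.
pose Q (a : A) := exists2 y : K, h y = a & y \in trace_sub e N m.
suff [y /std_ker_val_inj -> //] : Q (h x).
have : h x \in compress e (e i) (rank i).+1 by apply/std_ker_valP; exists x.
apply: (@compress_ind _ _ _ _ le _ (ee i) _ Q) => [|a b _ _ [y <- yN] [z <- zN]|a j b ltij].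
- by exists 0; [exact: linear0 | exact: rpred0].
- by exists (y + z); [exact: linearD | rewrite rpredD].
- have /std_ker_valP[y yE] := mem_compress_e le (ee i) a ltij.
  exists (y ** e j ** b).
    by rewrite !linear_ract yE -[LHS]/(e i * a * e j * e j * b) -[_ * e j * e j]mulrA ee.
  by apply/mem_ract/trace_subP => //; exact: leq_trans ltij.
Qed.

Lemma std_ker_multiplicity : (forall j, thin e j) ->
  forall j n, delta_multiplicity (std_module e) K j n -> n <> 0%N -> (i < j)%O.
Proof.
move=> thine j n [l [N [[[topN botN decN] deltaN] <-]]] cnt.
have [k /asboolP isok] : exists k : 'I_l, `[< isomorphic (layer N k) (std_module e j) >].
  apply: contrapT => nk; apply: cnt; apply: eq_card0 => k; rewrite !inE.
  by apply/negP => isok; apply: nk; exists k.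
rewrite ltErank ltnNge; apply/negP => leji.
(* The least such [k], whose index may differ from the given [j], has only layers of rank above
   [rank i] before it, as [std_steps_trace_full] requires. *)
have ex : exists k, `[< (k < l)%N /\ exists2 p, (rank p <= rank i)%N &
    isomorphic (layer N k) (std_module e p) >].
  by exists k; apply/asboolP; split=> //; exists j.
case: (ex_minnP ex) => {k j isok leji cnt} k.
move=> /asboolP[ltkl [j leji isok]] mink.
have [/negP[]] := thine j.
apply: (std_steps_trace_full le (m := (rank i).+1) (N := N) (k := k)) => //.
- by apply: std_ker_trace.
- move=> t lttk; have lttl := ltn_trans lttk ltkl.
  have [p isop] := deltaN t lttl; exists p; last by apply/(std_stepP le) => //; exact: decN.
  rewrite ltnNge; apply/negP => lepi; move: lttk; rewrite ltnNge => /negP; apply.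
  by apply: mink; apply/asboolP; split=> //; exists p.
- by apply/(std_stepP le) => //; exact: decN.
Qed.

End Kernel.

Variable S : I -> rmodType A.
Hypotheses (simS : forall i, simple_module (S i))
  (topS : forall i, exists s : S i, s ** e i != 0) (artA : artinian (rreg A)).

(** The right-hand side speaks only of elements of [A], so it can be matched with the heredity chain
    on either side. *)
Theorem right_strongly_quasi_hereditaryP :
  right_strongly_quasi_hereditary e S <->
  (forall i, thin e i) /\ forall m, has_right_dual_basis A (H m).
Proof.
split=> [[K [Kstd KP]]|[thine dual]].
  have KE i : K i = std_ker e i.
    by apply/(standard_kernelP le simS topS artA noeA)/Kstd.
  have {KE Kstd}KE : K = std_ker e by apply: functional_extensionality_dep.
  rewrite {}KE in KP; split=> [i|].
    have [mult _ _ _] := KP i.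
    exact: (std_multiplicityP le simS topS artA noeA i).1 mult.
  apply: compress_dual_all => // i; apply/std_ker_projective.
  by have [] := KP i.
have duali i m : has_right_dual_basis A (compress e (e i) m).
  exact: compress_dual_left.
exists (std_ker e); split=> i.
  exact/(standard_kernelP le simS topS artA noeA).
split.
- exact/(std_multiplicityP le simS topS artA noeA).
- exact: std_ker_filtered.
- exact: std_ker_multiplicity.
- exact/std_ker_projective.
Qed.

End StandardFiltration.

(** * Local idempotents from projective covers *)

Lemma noetherian_maximal (R : pzRingType) (M : lmodType R) (X : submod M) x :
  noetherian M -> x \notin X ->
  exists N : submod M, [/\ {subset X <= N}, x \notin N &
    forall N' : submod M, {subset N <= N'} -> x \notin N' -> {subset N' <= N}].
Proof.
move=> noeM nx; pose P (N : submod M) := {subset X <= N} /\ x \notin N.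
have [|N [[XN nxN] maxN]] := @noetherian_max _ _ P X noeM; first by split.
exists N; split=> // N' NN' nxN'; have : P N' by split=> // y /XN/NN'.
by move=> /maxN/(submod_ltPn NN') ->.
Qed.

Section ProjectiveCovers.
Variables (A : pzRingType) (I : finType) (e : I -> A) (S : I -> rmodType A).
Hypotheses (prim_e : forall i, primitive_idempotent (e i))
  (simS : forall i, simple_module (S i))
  (coverS : forall i, projective_cover (pright (e i)) (S i)).
Local Notation P i := (pright (e i)).

Let ee i : e i * e i = e i.
Proof. by have [] := prim_e i. Qed.

Let elt i a := pright_elt e i a.

Let eltM i a b : elt i (a * b) = elt i a ** b.
Proof. by apply: val_inj; rewrite /= mulrA. Qed.

Let elt_val i (v : P i) : v = elt i 1 ** (val v : A).
Proof.
apply: val_inj; rewrite -[RHS]/(e i * 1 * (val v : A)) mulr1.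
by have := valP v; rewrite inE => -[a <-]; rewrite mulrA ee.
Qed.

Let eltE i : elt i (e i) = elt i 1.
Proof. by apply: val_inj; rewrite /= ee mulr1. Qed.

Lemma cover_generator i : exists p : {linear P i -> S i},
  [/\ surjective p, p (elt i 1) != 0 &
      forall v, p v != 0 -> exists a, elt i 1 = v ** a].
Proof.
have [_ [p [surjp supp]]] := coverS i; exists p; split=> // [|v pv0].
  have [[s s0] _] := simS i; have [v vs] := surjp s.
  apply: contraNneq s0 => p0.
  by rewrite -vs (elt_val v) linear_ract p0 ract0l.
suff : elt i 1 \in cyclic v by move/submod_ofE.
apply: supp => w; have [a pa] := simple_cyclic (p w) (simS i) pv0.
exists (v ** a), (w - v ** a); split; last by rewrite addrC subrK.
  by apply/submod_ofE; exists a.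
by rewrite linearB linear_ract pa subrr.
Qed.

Lemma cover_top i : exists s : S i, s ** e i != 0.
Proof.
have [p [_ p0 _]] := cover_generator i; exists (p (elt i 1)).
by rewrite -linear_ract -eltM mul1r eltE.
Qed.

(** [y * x] is an idempotent of the corner, so by primitivity it is 0 or [e i], and 0 would give
    [e i = 0]. *)
Lemma primitive_corner_dir i x y : in_corner (e i) x -> in_corner (e i) y ->
  x * y = e i -> y * x = e i.
Proof.
move=> [xl xr] [yl yr] xy; have [_ e0 prim] := prim_e i.
have ff : (y * x) * (y * x) = y * x by rewrite mulrA -(mulrA y) xy yr.
have fe : y * x * e i = y * x by rewrite -mulrA xr.
have ef : e i * (y * x) = y * x by rewrite mulrA yl.
case: (prim (y * x) (e i - y * x)) => //.
- by rewrite mulrBr !mulrBl ee ff ef fe subrr subr0.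
- by rewrite mulrBr fe ff subrr.
- by rewrite mulrBl ef ff subrr.
- by rewrite addrC subrK.
- move=> yx0; case/eqP: e0.
  by rewrite -ee -xy mulrA -(mulrA x) yx0 mulr0 mul0r.
- by move/eqP; rewrite subr_eq0 => /eqP.
Qed.

Lemma cover_corner_unit i (p : {linear P i -> S i}) x :
  (forall v, p v != 0 -> exists a, elt i 1 = v ** a) ->
  in_corner (e i) x -> p (elt i x) != 0 -> corner_unit (e i) x.
Proof.
move=> genp xe px; have [a ea] := genp _ px.
have xa : x * (e i * a * e i) = e i.
  rewrite !mulrA xe.2; have := congr1 (fun v : P i => (val v : A)) ea.
  rewrite /= -[X in _ = X]/(e i * x * a) xe.1 mulr1 => <-.
  exact: ee.
have ce : in_corner (e i) (e i * a * e i).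
  by split; rewrite ?mulrA ?ee // -mulrA ee.
by exists (e i * a * e i); split=> //; exact: primitive_corner_dir.
Qed.

Hypotheses (isoS : forall i j, isomorphic (S i) (S j) -> i = j)
  (allS : forall M : rmodType A, simple_module M -> exists i, isomorphic M (S i))
  (noeA : noetherian (rreg A)).

(** The element [s ** e j] defines a surjection from [e j A] onto [S i]. Its kernel is that of the
    cover of [S j], since every element outside the latter generates [e j A]. *)
Lemma cover_unique i j (s : S i) : s ** e j != 0 -> i = j.
Proof.
move=> s0; have [p [surjp p0 genp]] := cover_generator j; apply: isoS.
pose F := linear_of (@cyclic_map_linear _ _ e _ j (s ** e j)).
have FE a : F (elt j a) = s ** e j ** a by rewrite /= !ractA mulrA ee.
have F1 : F (elt j 1) != 0 by rewrite FE ract1.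
have surjF : surjective F.
  by move=> y; have [a ->] := simple_cyclic y (simS i) s0; exists (elt j a); rewrite FE.
have kerF v : F v = 0 -> p v = 0.
  move=> Fv; apply: contrapT => /eqP/genp[a ea].
  by case/eqP: F1; rewrite ea linear_ract Fv ract0l.
apply: isomorphic_same_ker surjF surjp _ => v; split; first exact: kerF.
move=> pv; apply: contrapT => /eqP Fv.
have [a Fa] := simple_cyclic (F (elt j 1)) (simS i) Fv.
have /kerF : F (elt j 1 - v ** a) = 0 by rewrite linearB [F (v ** a)]linear_ract Fa subrr.
by rewrite linearB linear_ract pv ract0l subr0; apply/eqP.
Qed.

Lemma simple_quotient (N : submod (rreg A)) : (1 : rreg A) \notin N ->
  (forall N' : submod (rreg A), {subset N <= N'} -> (1 : rreg A) \notin N' ->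
     {subset N' <= N}) -> simple_module (quomodule N).
Proof.
move=> n1 maxN; split.
  by exists (quomodule_pi N 1); apply/eqP => /quomodule_pi_eq0; exact/negP.
move=> V.
have linpi : linear (quomodule_pi N).
  by move=> a x y; rewrite quomodule_piD quomodule_piZ.
pose Z := preim_sub (linear_of linpi) V.
have NZ : {subset N <= Z}.
  by move=> x xN; apply/submod_ofE; rewrite /= (quomodule_pi_eq0 N x).2 ?rpred0.
case: (boolP ((1 : rreg A) \in Z)) => [/submod_ofE /= oneV|noneZ]; [right|left] => q.
  rewrite -(quomodule_repr q); set a := repr _.
  have -> : a = (1 : rreg A) ** (a : A) by rewrite -[RHS]/(1 * (a : A)) mul1r.
  by rewrite quomodule_pi_ract mem_ract.
rewrite -(quomodule_repr q) => qV; apply/quomodule_pi_eq0.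
by apply: (maxN Z) => //; apply/submod_ofE.
Qed.

Lemma cover_local_idempotents : local_idempotents e.
Proof.
split=> [//|i|i x y|i x xe nx|i j a b ij [z [_ uz _]]|H eH x].
- by have [] := prim_e i.
- exact: primitive_corner_dir.
- have [p [_ p0 genp]] := cover_generator i.
  have px : p (elt i x) = 0.
    by apply: contrapT => /eqP px; apply: nx; exact: cover_corner_unit genp xe px.
  apply: (cover_corner_unit genp).
    by split; rewrite (mulrBr, mulrBl) ee (xe.1, xe.2).
  have -> : elt i (e i - x) = elt i 1 - elt i x.
    by apply: val_inj; rewrite /= mulrBr ee -[RHS]/(e i * 1 - e i * x) mulr1.
  by rewrite linearB px subr0.
(* A unit factoring through [e j] would make [e j] act nontrivially on the image of [e i * a] in
   [S i]. *)
- apply: ij; have [p [_ p0 _]] := cover_generator i.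
  apply: (@cover_unique i j (p (elt i a))); apply: contra_neq p0 => s0.
  have -> : elt i 1 = elt i a ** e j ** (b * e i * z).
    by rewrite -!eltM; apply: val_inj; rewrite /= mulr1 -{1}uz !mulrA.
  by rewrite !linear_ract s0 ract0l.
(* A proper ideal containing every [e i] lies in a maximal right ideal [N]. Each [e i] kills the
   simple module [A / N], which is isomorphic to some [S i], where [e i] acts nontrivially. *)
- apply/negPn/negP => nx.
  have n1 : (1 : rreg A) \notin Submod (ideal_right_closed H).
    apply: contra nx => oneH.
    by have := ideal_mull x (oneH : (1 : A) \in H); rewrite mulr1.
  have [N [HN nN maxN]] := noetherian_maximal noeA n1.
  have [i isoi] := allS (simple_quotient nN maxN).
  have [f [g fK gK]] := isoi; have [s s0] := cover_top i.
  case/eqP: s0; rewrite -(gK s) -linear_ract -(quomodule_repr (g s)).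
  rewrite -quomodule_pi_ract; set a := repr _.
  have -> : quomodule_pi N (a ** e i) = 0; last exact: linear0.
  apply/quomodule_pi_eq0/HN.
  exact: (ideal_mull (a : A) (eH i)).
Qed.

End ProjectiveCovers.

(** * The radical condition *)

Section QuotientRingTheory.
Variables (A : pzRingType) (J : ideal A).
Local Notation Q := (quoring J).
Local Notation pi := (quoring_pi J).

Lemma quoring_piM (x y : A) : pi (x * y) = pi x * pi y.
Proof. exact/esym/quoring_mulE. Qed.

Lemma quoring_pi_eq0 (x : A) : pi x = 0 <-> x \in J.
Proof.
have pi0 : pi 0 = 0 by apply: (addrI (pi 0)); rewrite -quoring_piD !addr0.
by rewrite -pi0 -[x in x \in _]subr0 -quoring_eq; split=> /eqP.
Qed.

Lemma quoring_piB (x y : A) : pi (x - y) = pi x - pi y.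
Proof. by apply: (addIr (pi y)); rewrite -quoring_piD !subrK. Qed.

Lemma quoring_piP (q : Q) : exists x, q = pi x.
Proof. by exists (repr (q : Quotient.quot J)); rewrite quoring_repr. Qed.

Fact quoring_preim0 (X : submod (rreg Q)) : (pi 0 : rreg Q) \in X.
Proof. by rewrite (quoring_pi_eq0 0).2 ?rpred0 //; exact: (rpred0 X). Qed.

Fact quoring_preimD (X : submod (rreg Q)) (a : A^c) (x y : rreg A) :
  (pi x : rreg Q) \in X -> (pi y : rreg Q) \in X ->
  (pi (a *: x + y) : rreg Q) \in X.
Proof.
move=> xX yX; have : (pi x : rreg Q) ** pi a + pi y \in X by rewrite rpredD ?mem_ract.
by rewrite -[(pi x : rreg Q) ** pi a]/(pi x * pi a) -quoring_piM -quoring_piD.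
Qed.

Definition quoring_preim X : submod (rreg A) :=
  submod_of (quoring_preim0 X) (@quoring_preimD X).

Lemma quoring_noetherian : noetherian (rreg A) -> noetherian (rreg Q).
Proof.
apply: (@noetherian_transfer _ _ _ _ quoring_preim) => X Y.
  by move=> sXY x /submod_ofE xX; apply/submod_ofE; exact: sXY.
move=> XY q; have [x ->] := quoring_piP q; apply/idP/idP => pX.
  by apply/(submod_ofE (quoring_preim0 Y) (@quoring_preimD Y)); rewrite -XY; apply/submod_ofE.
by apply/(submod_ofE (quoring_preim0 X) (@quoring_preimD X)); rewrite XY; apply/submod_ofE.
Qed.

End QuotientRingTheory.

(** No maximal right ideal contains [1 - g], since it contains [y] and hence [g]. So [1 - g] has a
    right inverse [b], and [g = g * (1 - g) * b = 0]. *)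
Lemma jacobson_idempotent (R : pzRingType) (y a : R) : noetherian (rreg R) ->
  jacobson R y -> y * a * (y * a) = y * a -> y * a = 0.
Proof.
move=> noeR Jy; set g := y * a => gg.
suff [b b1] : exists b, 1 = (1 - g) * b.
  by rewrite -[g]mulr1 b1 mulrA mulrBr mulr1 gg subrr mul0r.
apply: contrapT => n1.
have n1' : (1 : rreg R) \notin cyclic (1 - g : rreg R).
  by apply/negP => /submod_ofE.
have [N [gN nN maxN]] := noetherian_maximal noeR n1'.
have yN : (y : rreg R) \in N.
  apply: Jy; first by exists 1.
  move=> N' NN'; case: (boolP ((1 : rreg R) \in N')) => [oneN'|noneN'].
    left=> z; have := mem_ract (z : R) oneN'.
    by rewrite -[(1 : rreg R) ** _]/(1 * (z : R)) mul1r.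
  by right; exact: maxN.
have gN' : (g : rreg R) \in N by exact: (mem_ract a yN).
have gN1 : (1 - g : rreg R) \in N.
  by apply: gN; apply/submod_ofE; exists 1; rewrite ract1.
case/negP: nN; have : ((1 - g : R) + g : rreg R) \in N := rpredD gN1 gN'.
by rewrite subrK.
Qed.

Section HeredityChain.
Variables (A : pzRingType) (d : Order.disp_t) (I : finOrderType d) (e : I -> A).
Hypotheses (le : local_idempotents e) (noeA : noetherian (rreg A)).
Local Notation H := (order_chain e).
Let ee := li_idem le.

Lemma order_chain_idempotent m :
  prodset [set` H m]%classic [set` H m]%classic = [set` H m]%classic.
Proof.
apply/seteqP; split=> x /=.
  move=> [s sP ->]; rewrite big_seq; elim/big_ind: _ => [|u v|p /sP[_]].
  - exact: (rpred0 (H m)).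
  - exact: (@rpredD _ (H m)).
  - exact: (@ideal_mull _ (H m)).
move: x; apply: order_chain_ind => [|x y|a j b lemj]; first exact: prodset0.
  exact: prodsetD.
exists [:: (a * e j, e j * b)]; last first.
  by rewrite big_seq1 /= mulrA -(mulrA a (e j) (e j)) ee.
have ej : e j \in H m by exact: mem_order_chain.
move=> p; rewrite inE => /eqP -> /=.
split; [exact: (@ideal_mull _ (H m)) | exact: (@ideal_mulr _ (H m))].
Qed.

Lemma order_chain_strict : idempotent_ideal_chain #|I| H <->
  forall i, e i \notin H (rank i).+1.
Proof.
split=> [[_ _ strict _] i|strict].
  have [_ [x xH nx]] := strict _ (rank_lt i).
  apply: contra nx => eH; move: x xH.
  apply: order_chain_ind => [|x y|a j b leij]; [exact: rpred0 | exact: rpredD |].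
  apply/ideal_mulr/ideal_mull; have [-> //|ltij] := eq_or_rank_lt leij.
  exact: mem_order_chain.
split=> [x|x|k ltk|k _].
- exact: order_chain_bot.
- exact: order_chain_top.
- split; first exact: order_chain_sub.
  have rk := rank_enum_val (Ordinal ltk).
  exists (e (Order.enum_val (Ordinal ltk))); first by apply: mem_order_chain; rewrite // rk.
  by have := strict (Order.enum_val (Ordinal ltk)); rewrite rk.
- exact: order_chain_idempotent.
Qed.

Section Radical.
Variable i : I.
Local Notation J := (H (rank i).+1).
Local Notation Q := (quoring J).
Local Notation pi := (quoring_pi J).

(** If a maximal right ideal [N] missed [x], then [e i = n + x * a] modulo [J] with [n] in [N]. The
    unit [u = e i - x * (e i * a * e i)] would lie in [N] modulo [J], and so would [x = u * z * x]
    with [z] inverse to [u]. *)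
Lemma nonunit_jacobson x : in_corner (e i) x -> ~ corner_unit (e i) x ->
  jacobson Q (pi x).
Proof.
move=> xe nx N _ maxN; apply: contrapT => /negP xN.
pose Np (y : rreg Q) := exists (n : rreg Q) (q : Q),
  n \in N /\ y = n + (pi x : rreg Q) ** q.
have Np0 : Np 0 by exists 0, 0; rewrite ract0 addr0; split=> //; exact: rpred0.
have NpD (a : Q^c) (u v : rreg Q) : Np u -> Np v -> Np (a *: u + v).
  move=> [n [q [nN ->]]] [n' [q' [n'N ->]]]; exists (n ** a + n'), (q * a + q').
  split; first by rewrite rpredD ?mem_ract.
  by rewrite scale_ract ractDl ractDr ractA addrACA.
have [] := maxN (submod_of Np0 NpD).
- by move=> n nN; apply/submod_ofE; exists n, 0; rewrite ract0 addr0.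
- move=> /(_ (pi (e i) : rreg Q))/submod_ofE[n [q [nN]]].
  have [a ->] := quoring_piP q => en.
  pose u := e i - x * (e i * a * e i).
  have [z [_ uz _]] : corner_unit (e i) u.
    apply: (li_loc le); first exact: in_cornerM xe (in_cornerE le i a).
    by move=> /(corner_unitMl le xe (in_cornerE le i a)).
  have uN : (pi u : rreg Q) \in N.
    have -> : (pi u : rreg Q) = n ** pi (e i); last exact: mem_ract.
    have -> : n = pi (e i) - pi x * pi a by rewrite en addrK.
    rewrite -[RHS]/((pi (e i) - pi x * pi a) * pi (e i)).
    by rewrite mulrBl -!quoring_piM -quoring_piB ee /u !mulrA xe.2.
  case/negP: xN; have := mem_ract (pi (z * x)) uN.
  rewrite -[(pi u : rreg Q) ** _]/(pi u * pi (z * x)) -quoring_piM mulrA uz.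
  by rewrite xe.1.
- move=> sub; case/negP: xN; apply: sub; apply/submod_ofE; exists 0, 1.
  by rewrite ract1 add0r; split=> //; exact: rpred0.
Qed.

Lemma radical_thin : e i \notin J ->
  radical_condition (H (rank i)) J <->
  forall x, in_corner (e i) x -> ~ corner_unit (e i) x -> x \in J.
Proof.
move=> nei; rewrite /radical_condition /=.
set HH := image _ _.
have eHH : HH (pi (e i)) by exists (e i) => //=; exact: mem_order_chain.
split=> [rad x xe nx|nonunit].
  suff : prodset (prodset HH (jacobson Q)) HH (pi x) by rewrite rad => /quoring_pi_eq0.
  exists [:: (pi x, pi (e i))]; last by rewrite big_seq1 /= -quoring_piM xe.2.
  move=> p; rewrite inE => /eqP -> /=; split=> //.
  exists [:: (pi (e i), pi x)]; last by rewrite big_seq1 /= -quoring_piM xe.1.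
  move=> q; rewrite inE => /eqP -> /=; split=> //.
  exact: nonunit_jacobson.
(* A non-unit value lies in [J] by assumption. A unit value yields [w] with [e i * c * y * w = e i];
   then [y * w * e i * c] is an idempotent right multiple of a radical element, hence 0, which would
   put [e i] in [J]. *)
have corner0 (c c' : A) (y : Q) : jacobson Q y ->
    pi (e i * c) * y * pi (c' * e i) = 0.
  move=> Jy; have [y0 yE] := quoring_piP y; rewrite yE -!quoring_piM.
  have -> : e i * c * y0 * (c' * e i) = e i * (c * y0 * c') * e i by rewrite !mulrA.
  apply/quoring_pi_eq0.
  have [[z [_ uz _]]|nu] := EM (corner_unit (e i) (e i * (c * y0 * c') * e i)); last first.
    by apply: nonunit => //; exact: in_cornerE.
  have [w ew] : exists w, e i * c * y0 * w = e i.
    by exists (c' * e i * z); rewrite -[RHS]uz !mulrA.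
  have E : e i * c * (y0 * (w * (e i * c))) = e i * c by rewrite !mulrA ew ee.
  have g0 : y * pi (w * (e i * c)) = 0.
    apply: jacobson_idempotent => //; first exact: quoring_noetherian.
    rewrite yE -(quoring_piM _ y0 (w * (e i * c))) -quoring_piM; congr (pi _).
    by rewrite -[LHS]mulrA -[w * _ * _]mulrA E.
  case/negP: nei; apply/quoring_pi_eq0.
  have -> : e i = e i * c * (y0 * (w * (e i * c))) * (y0 * w) by rewrite E mulrA ew.
  by rewrite quoring_piM quoring_piM [pi (y0 * _)]quoring_piM -yE g0 mulr0 mul0r.
apply/seteqP; split=> q /=; last first.
  by move=> ->; exact: prodset0.
move=> [s sP ->]; rewrite big_seq big1 // => p /sP[[t tP ->] [b bH <-]].
rewrite mulr_suml big_seq big1 // => r /tP[[a aH <-] Jr] {p sP s tP t}.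
move: a aH; apply: order_chain_ind => [|x y xa ya|c p c' leip].
- by rewrite (quoring_pi_eq0 _ 0).2 ?rpred0 // !mul0r.
- by rewrite quoring_piD !mulrDl xa ya addr0.
(* Modulo [J] only the idempotent [e i] itself contributes to [H (rank i)]. *)
have [->|ltip] := eq_or_rank_lt leip; last first.
  have -> : pi (c * e p * c') = 0; last by rewrite !mul0r.
  by apply/quoring_pi_eq0/ideal_mulr/ideal_mull/mem_order_chain.
move: b bH; apply: order_chain_ind => [|x y xa ya|b j b' leij].
- by rewrite (quoring_pi_eq0 _ 0).2 ?rpred0 // !mulr0.
- by rewrite quoring_piD mulrDr xa ya addr0.
have [->|ltij] := eq_or_rank_lt leij; last first.
  have -> : pi (b * e j * b') = 0; last by rewrite !mulr0.
  by apply/quoring_pi_eq0/ideal_mulr/ideal_mull/mem_order_chain.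
rewrite -(mulrA c) (quoring_piM _ c) (quoring_piM _ (b * e i)).
by rewrite mulrA -[pi c * _ * _]mulrA -[pi c * _ * _]mulrA corner0 // mulr0 mul0r.
Qed.

End Radical.
End HeredityChain.

Section Chain.
Variables (A : pzRingType) (d : Order.disp_t) (I : finOrderType d) (e : I -> A).
Hypotheses (le : local_idempotents e) (noeA : noetherian (rreg A)).
Local Notation H := (order_chain e).

Lemma heredity_chain_thin :
  idempotent_ideal_chain #|I| H /\
    (forall k, (k < #|I|)%N -> radical_condition (H k) (H k.+1)) <->
  forall i, thin e i.
Proof.
split=> [[/(order_chain_strict le) strict rad] i|thine].
  split; first exact: strict.
  by apply/(radical_thin le noeA) => //; apply: rad; exact: rank_lt.
split; first by apply/(order_chain_strict le) => i; have [] := thine i.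
move=> k ltk; have rk := rank_enum_val (Ordinal ltk).
have [nei nonunit] := thine (Order.enum_val (Ordinal ltk)).
have := (radical_thin le noeA nei).2 nonunit.
by rewrite rk.
Qed.

(** From index [#|I|] on the ideals vanish, so the bounded range of a heredity chain agrees with the
    unbounded one of the dual basis criterion. *)
Lemma chain_dual (D : {pred A} -> Prop) : (forall X, (forall x, x \in X -> x = 0) ->
    0 \in X -> D X) ->
  (forall m, (m < #|I|)%N -> D (H m)) <-> forall m, D (H m).
Proof.
move=> D0; split=> DH m => [|_]; last exact: DH.
have [|lem] := ltnP m #|I|; first exact: DH.
apply: D0 => [x|]; last exact: rpred0.
exact: order_chain_top.
Qed.

End Chain.

Lemma has_dual_basis_zero (R : pzRingType) (X : {pred R}) :
  (forall x, x \in X -> x = 0) -> 0 \in X -> has_dual_basis X.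
Proof.
move=> X0 zeroX; exists void, (fun=> 0), (fun _ _ => 0).
by split=> [[]|[]|x /X0 ->] //; rewrite big1 // => -[].
Qed.

(** * The opposite ring *)

Section Converse.
Variable A : pzRingType.

Lemma in_corner_converse (f x : A) : @in_corner A^c f x <-> in_corner f x.
Proof. by split=> -[]. Qed.

Lemma corner_unit_converse (f x : A) : @corner_unit A^c f x <-> corner_unit f x.
Proof. by split=> -[y [[yl yr] xy yx]]; exists y; split. Qed.

Lemma primitive_idempotent_converse (f : A) :
  primitive_idempotent f -> @primitive_idempotent A^c f.
Proof. by move=> [ff f0 prim]; split=> // g h gg hh gh hg; exact: prim. Qed.

Section Ideal.
Variable H : ideal A^c.

Definition ideal_converse : ideal A :=
  @Ideal A H (ideal_zmod_closed H) (@ideal_mulr A^c H) (@ideal_mull A^c H).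

End Ideal.

Lemma local_idempotents_converse (I : finType) (e : I -> A) :
  local_idempotents e -> @local_idempotents A^c I e.
Proof.
move=> le; split=> [i|i|i x y|i x|i j a b ij|H eH x].
- exact: li_idem le i.
- exact: li_neq0 le i.
- move=> /in_corner_converse xe /in_corner_converse ye yx.
  exact: (li_dir le ye xe yx).
- move=> /in_corner_converse xe nx; apply/corner_unit_converse/(li_loc le xe).
  by move=> /corner_unit_converse.
- have nu : ~ corner_unit (e i) (e i * ((b : A) * (e j * ((a : A) * e i)))).
    by rewrite !mulrA; exact: li_orth.
  by move=> /corner_unit_converse; exact: nu.
- exact: (li_full le (H := ideal_converse H)).
Qed.

Lemma order_chain_converse (d : Order.disp_t) (I : finOrderType d) (e : I -> A) m :
  local_idempotents e -> @order_chain A^c d I e m =i order_chain e m.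
Proof.
move=> le x; have leC := local_idempotents_converse le; apply/idP/idP.
  apply: (@order_chain_ind A^c d I e m (fun x => x \in order_chain e m)).
  - exact: (rpred0 (order_chain e m)).
  - exact: (@rpredD _ (order_chain e m)).
  - move=> a j b lemj.
    apply: (@ideal_mull _ (order_chain e m) b (e j * (a : A))).
    by apply/ideal_mulr/mem_order_chain.
apply: (@order_chain_ind A d I e m (fun x => x \in @order_chain A^c d I e m)).
- exact: (rpred0 (@order_chain A^c d I e m)).
- exact: (@rpredD _ (@order_chain A^c d I e m)).
- move=> a j b lemj.
  apply: (@ideal_mull A^c (@order_chain A^c d I e m) b (a * e j)).
  apply: (@ideal_mulr A^c (@order_chain A^c d I e m) a (e j)).
  exact: mem_order_chain.
Qed.

End Converse.

(** * Artin algebras *)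

Section ArtinAlgebra.
Variables (k : comNzRingType) (A : algType k).
Implicit Types c : k.

Section Right.
Variable X : submod (rreg A).

Fact right_k_sub0 : (0 : A) \in X.
Proof. exact: (rpred0 X). Qed.

Fact right_k_subD c (x y : A) : x \in X -> y \in X -> c *: x + y \in X.
Proof.
move=> xX yX; rewrite -mulr_algr.
exact: (@rpredD _ X _ _ (mem_ract (X := X) c%:A xX) yX).
Qed.

Definition right_k_sub : submod (A : lmodType k) :=
  submod_of right_k_sub0 right_k_subD.

Lemma right_k_subE (x : A) : x \in right_k_sub = (x \in X).
Proof. by apply/idP/idP => [/submod_ofE|xX] //; apply/submod_ofE. Qed.

End Right.

Section Left.
Variable X : submod (A^o : lmodType A).

Fact left_k_sub0 : (0 : A) \in X.
Proof. exact: (rpred0 X). Qed.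

Fact left_k_subD c (x y : A) : x \in X -> y \in X -> c *: x + y \in X.
Proof.
move=> xX yX; rewrite -mulr_algl.
exact: (@rpredD _ X _ _ (@rpredZ A A^o X c%:A x xX) yX).
Qed.

Definition left_k_sub : submod (A : lmodType k) :=
  submod_of left_k_sub0 left_k_subD.

Lemma left_k_subE (x : A) : x \in left_k_sub = (x \in X).
Proof. by apply/idP/idP => [/submod_ofE|xX] //; apply/submod_ofE. Qed.

End Left.

Section Converse.
Variable X : submod (rreg A^c).

Fact converse_sub_closed : submod_closed ((X : {pred A}) : {pred (A^o : lmodType A)}).
Proof. exact: (submodP X). Qed.

Definition converse_sub : submod (A^o : lmodType A) := Submod converse_sub_closed.

End Converse.

Hypothesis artinA : artin_algebra A.

Lemma artin_algebra_right : artinian (rreg A) /\ noetherian (rreg A).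
Proof.
have mono (X Y : submod (rreg A)) :
    {subset X <= Y} -> {subset right_k_sub X <= right_k_sub Y}.
  by move=> XY x; rewrite !right_k_subE; exact: XY.
have inj (X Y : submod (rreg A)) : right_k_sub X =i right_k_sub Y -> X =i Y.
  by move=> XY x; have := XY x; rewrite !right_k_subE.
split.
  exact: artinian_transfer mono inj (artin_algebra_artinian artinA).
exact: noetherian_transfer mono inj (artin_algebra_noetherian artinA).
Qed.

Lemma artin_algebra_left :
  artinian (A^o : lmodType A) /\ noetherian (A^o : lmodType A).
Proof.
have mono (X Y : submod (A^o : lmodType A)) :
    {subset X <= Y} -> {subset left_k_sub X <= left_k_sub Y}.
  by move=> XY x; rewrite !left_k_subE; exact: XY.
have inj (X Y : submod (A^o : lmodType A)) : left_k_sub X =i left_k_sub Y -> X =i Y.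
  by move=> XY x; have := XY x; rewrite !left_k_subE.
split.
  exact: artinian_transfer mono inj (artin_algebra_artinian artinA).
exact: noetherian_transfer mono inj (artin_algebra_noetherian artinA).
Qed.

Lemma artin_algebra_converse :
  artinian (rreg A^c) /\ noetherian (rreg A^c).
Proof.
have [artA noeA] := artin_algebra_left; split.
  by apply: (artinian_transfer (F := converse_sub)) artA.
by apply: (noetherian_transfer (F := converse_sub)) noeA.
Qed.

End ArtinAlgebra.

Theorem proposition3p7 (k : comNzRingType) (A : algType k)
  (artinA : artin_algebra A)
  (d : Order.disp_t) (I : finOrderType d)
  (S : I -> rmodType A) (reprS : simple_representatives S)
  (e : I -> A) (prim_e : forall i, primitive_idempotent (e i))
  (coverS : forall i, projective_cover (pright (e i)) (S i)) :
  (right_strongly_quasi_hereditary e S <->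
     right_strongly_heredity_chain #|I| (order_chain e)) /\
  (forall S' : I -> rmodType A^c,
     (forall i, simple_module (S' i)) ->
     (forall i, projective_cover (@pright A^c (e i)) (S' i)) ->
     (left_strongly_quasi_hereditary e S' <->
        left_strongly_heredity_chain #|I| (order_chain e))).
Proof.
have [simS isoS allS] := reprS.
have [artR noeR] := artin_algebra_right artinA.
have [_ noeL] := artin_algebra_left artinA.
have [artC noeC] := artin_algebra_converse artinA.
have le := cover_local_idempotents prim_e simS coverS isoS allS noeR.
have thinP := heredity_chain_thin le noeR.
split.
  have topS := cover_top prim_e simS coverS.
  rewrite (right_strongly_quasi_hereditaryP le noeR simS topS artR) -thinP.
  rewrite -(chain_dual e (D := has_right_dual_basis A)); last first.
    by move=> X X0 zeroX; apply/has_right_dual_basisE/has_dual_basis_zero.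
  have projP m : projective (ideal_rmodule (order_chain e m)) <->
      has_right_dual_basis A (order_chain e m).
    rewrite has_right_dual_basisE; exact: projective_submodule.
  split=> [[[chain rad] dual]|[chain h]].
    split=> // m ltm; split; [exact/projP/dual | exact: rad].
  by split; [split=> // m /h[] | move=> m /h[/projP]].
move=> S' simS' coverS'.
(* The modules [S'] supply only the action of the [e i] on their tops; the ring-theoretic conditions
   come from the right side by symmetry. *)
have leC := local_idempotents_converse le.
have prim_eC i := primitive_idempotent_converse (prim_e i).
have topS' := cover_top prim_eC simS' coverS'.
rewrite /left_strongly_quasi_hereditary.
rewrite (right_strongly_quasi_hereditaryP leC noeC simS' topS' artC).
have thinC i : @thin A^c d I e i <-> thin e i.
  rewrite /thin order_chain_converse //; split=> -[nei nu]; split=> // x xe nx.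
    rewrite -order_chain_converse //; apply: nu; first exact/in_corner_converse.
    by move=> /corner_unit_converse.
  rewrite order_chain_converse //; apply: nu; first exact/in_corner_converse.
  by move=> /corner_unit_converse.
have thinCP : (forall i, @thin A^c d I e i) <-> (forall i, thin e i).
  by split=> h i; apply/thinC.
have projP m : projective (ideal_lmodule (order_chain e m)) <->
    has_right_dual_basis A^c (@order_chain A^c d I e m).
  rewrite /ideal_lmodule projective_submodule //.
  split=> -[T [g [phi [gX phiX phiK]]]]; exists T, g, phi; split.
  - by move=> t; rewrite order_chain_converse.
  - by move=> t a x y; rewrite !order_chain_converse //; exact: phiX.
  - by move=> x; rewrite order_chain_converse //; exact: phiK.
  - by move=> t; rewrite -order_chain_converse.
  - by move=> t a x y; rewrite -!(order_chain_converse _ le); exact: phiX.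
  - by move=> x; rewrite -order_chain_converse //; exact: phiK.
rewrite thinCP -thinP -(chain_dual (A := A^c) e (D := has_right_dual_basis A^c)); last first.
  move=> X X0 zeroX; apply/has_right_dual_basisE.
  exact: (@has_dual_basis_zero (A^c)^c).
split=> [[[chain rad] dual]|[chain h]].
  split=> // m ltm; split; [exact/projP/dual | exact: rad].
by split; [split=> // m /h[] | move=> m /h[/projP]].
Qed.
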